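(* Let $\bm{k}$ be a valued field and let $f_{1}(z),\ldots,f_{n}(z)\in\overline{\bm{k}}\{z\}$ be analytic functions on a domain $\mathcal{U}\subseteq\tilde{\bm{k}}$ containing the origin. Let $\alpha\in\mathcal{U}\cap\overline{\bm{k}}$. Assume that the extension $\overline{\bm{k}}(z)(f_{1}(z),\ldots,f_{n}(z))$ is not regular over $\overline{\bm{k}}(z)$. Then $$\mathrm{ev}_{\alpha}\big(\tilde{\mathfrak{p}}\cap\overline{\bm{k}}[z][X_{0},\ldots,X_{n}]\big)\subsetneq\tilde{\mathfrak{p}}_{\alpha}.$$ Equivalently, there is a homogeneous polynomial $P\in\overline{\bm{k}}[X_0,\ldots,X_n]$ with $P(1,f_1(\alpha),\ldots,f_n(\alpha))=0$ which is not of the form $Q(\alpha,X_0,\ldots,X_n)$ for any $Q\in\overline{\bm{k}}[z][X_0,\ldots,X_n]$ homogeneous in the $X_i$ with $Q(z,1,f_1(z),\ldots,f_n(z))=0$.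
   Context: $\bm{k}_c$ is the completion of $\bm{k}$; its valuation extends uniquely to $\overline{\bm{k}_c}$, and $\tilde{\bm{k}}$ is the completion of $\overline{\bm{k}_c}$ (complete and algebraically closed); $\overline{\bm{k}}\subseteq\tilde{\bm{k}}$. $\overline{\bm{k}}\{z\}$ denotes power series with coefficients in $\overline{\bm{k}}$ converging near $0$. A function is analytic on $\mathcal{U}$ if at each point of $\mathcal{U}$ it admits a convergent power series expansion with coefficients in $\tilde{\bm{k}}$ in a connected open neighbourhood. Set $\mathfrak{p}=\{Q\in\overline{\bm{k}}(z)[X_{1},\ldots,X_{n}]: Q(z,f_{1}(z),\ldots,f_{n}(z))=0\}$ and $\mathfrak{p}_{\alpha}=\{P\in\overline{\bm{k}}[X_{1},\ldots,X_{n}]: P(f_{1}(\alpha),\ldots,f_{n}(\alpha))=0\}$. For an ideal $\mathfrak{q}$ of $R[X_1,\ldots,X_n]$, its homogenization $\tilde{\mathfrak{q}}$ is the ideal of $R[X_0,\ldots,X_n]$ generated by all homogeneous $Q$ such that $Q(1,X_1,\ldots,X_n)\in\mathfrak{q}$. $\mathrm{ev}_{\alpha}(I)$, for an ideal $I$ of $\overline{\bm{k}}[z][X_0,\ldots,X_n]$, is the ideal $\{Q(\alpha,X_0,\ldots,X_n): Q\in I\}$ of $\overline{\bm{k}}[X_0,\ldots,X_n]$. A finitely generated field extension $\mathcal{E}$ of a field $\bm{k}'$ is regular if it is separable over $\bm{k}'$ (there is a transcendence basis $\mathcal{F}$ with $\mathcal{E}/\bm{k}'(\mathcal{F})$ separable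 algebraic) and every element of $\mathcal{E}$ algebraic over $\bm{k}'$ lies in $\bm{k}'$.
   Formalization: For ultrametric absolute values, where connected open sets are void and merely local expansions make the claim false, the domain U is taken to be a disc and each f_i is given by power series converging on all of U; domains with holes are not covered. *)

(* Defs.v *)
From HB Require Import structures.
From mathcomp Require Import all_boot all_order all_algebra all_field.
From mathcomp Require Import generic_quotient.
From mathcomp Require Import (canonicals, coercions) mpoly.
From mathcomp Require Import all_classical all_reals.
From mathcomp Require Import topology sequences.

Set Implicit Arguments.
Unset Strict Implicit.
Unset Printing Implicit Defensive.

Import Order.TTheory GRing.Theory Num.Theory.

Local Open Scope classical_set_scope.
Local Open Scope ring_scope.

HB.mixin Record MetricField_isValued (R : realType) K
    of GRing.Field K & Metric R K := {
  absv : K -> R ;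
  absv_ge0 : forall x, 0 <= absv x ;
  absv_eq0 : forall x, (absv x == 0) = (x == 0) ;
  absvM : forall x y, absv (x * y) = absv x * absv y ;
  absvD : forall x y, absv (x + y) <= absv x + absv y ;
  mdist_absv : forall x y : K, mdist x y = absv (x - y)
}.

(** A field with a real absolute value, archimedean or not, possibly trivial,
    together with the metric topology that it induces. *)
#[short(type="valuedFieldType")]
HB.structure Definition ValuedField (R : realType) :=
  {K of GRing.Field K & Metric R K & MetricField_isValued R K}.

Section Subfields.
Context {M : fieldType}.
Implicit Types (S E : set M).

Definition is_subfield S : Prop := GRing.divring_closed (mem S).

Definition subfield_gen (X : set M) : set M := smallest is_subfield X.

Definition algebraic_over S (x : M) : Prop :=
  exists p : {poly M}, [/\ p \is a polyOver (mem S), p != 0 & root p x].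

Definition separable_over S (x : M) : Prop :=
  exists p : {poly M},
    [/\ p \is a polyOver (mem S), separable_poly p & root p x].

Definition alg_independent S (r : nat) (t : 'I_r -> M) : Prop :=
  forall P : mpoly.mpoly r M,
    P \is a @mpoly.mpolyOver r M (mem S) -> mpoly.meval t P = 0 -> P = 0.

(** Regularity of a finitely generated extension [E] of [S]; the transcendence
    bases of such an extension are finite, whence the finite family [t]. *)
Definition regular_extension S E : Prop :=
  (exists (r : nat) (t : 'I_r -> M),
     [/\ range t `<=` E,
         alg_independent S t &
         forall x, E x -> separable_over (subfield_gen (S `|` range t)) x]) /\
  (forall x, E x -> algebraic_over S x -> S x).

End Subfields.

Definition algebraic_closure (K Kbar : fieldType) (i : K -> Kbar) : Prop :=
  GRing.closed_field_axiom Kbar /\ forall x, algebraicOver i x.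

Definition complete_space (T : uniformType) : Prop :=
  forall F : set_system T, ProperFilter F -> cauchy F -> exists l : T, F --> l.

(** [L] is the completion of an algebraic closure of the completion of [K]:
    inside the complete field [L], the completion of [K] is the closure of the
    image of [K]; as [L] is algebraically closed, the elements that are
    algebraic over this closure form an algebraic closure of it, and the last
    clause says that [L] is the completion of the latter. *)
Definition completed_algebraic_closure (R : realType) (K L : valuedFieldType R)
    (iota : K -> L) : Prop :=
  [/\ forall x, absv (iota x) = absv x,
      complete_space L,
      GRing.closed_field_axiom L &
      dense [set x : L | algebraic_over (closure (range iota)) x]].

Section Analytic.
Context {R : realType} {L : valuedFieldType R}.
Implicit Types (U V : set L) (F : L -> L) (a z : L) (c : nat -> L).

Definition ultrametric : Prop :=
  forall x y : L, absv (x + y) <= Num.max (absv x) (absv y).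

(** Over an ultrametric [L], the nonempty sets with this property are the
    discs, open or closed, of finite or infinite radius. *)
Definition disc_convex U : Prop :=
  forall x y z, U x -> U y -> absv (z - x) <= absv (y - x) -> U z.

(** A nontrivial ultrametric [L] is totally disconnected, so that topological
    connectedness is void there; discs then take over the role of the connected
    open sets. *)
Definition domain U : Prop :=
  [/\ open U, ~ ultrametric -> connected U & ultrametric -> disc_convex U].

(** [c] is the sequence of coefficients of an expansion at [a] of the function
    [F], valid on a connected open neighbourhood of [a] in [U].  In the
    ultrametric case this neighbourhood is the disc [U] itself: expansions on
    smaller discs would only express that [F] is locally analytic, a notion
    without analytic continuation. *)
Definition expansion_at U F a c : Prop :=
  exists V, [/\ open_nbhs a V, V `<=` U,
    ~ ultrametric -> connected V, ultrametric -> V = U &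
    forall z, V z -> series (fun m => c m * (z - a) ^+ m) @ \oo --> F z].

Definition analytic_on U F : Prop :=
  forall a, U a -> exists c, expansion_at U F a c.

Definition convergent_near0 c : Prop :=
  exists2 r : R, 0 < r &
    forall z, absv z < r ->
      exists l : L, series (fun m => c m * z ^+ m) @ \oo --> l.

End Analytic.

Arguments ultrametric {R} L.

Local Notation "x %:F" := (FracField.tofrac x).

Lemma fraction_numden (A : idomainType) (x : {fraction A}) :
  x * ((frac (repr x)).2)%:F = ((frac (repr x)).1)%:F.
Proof.
have d0 : (frac (repr x)).2 != 0 by exact: denom_ratioP.
rewrite -{1}[x]reprK; set r := repr x in d0 *; unlock FracField.tofrac.
rewrite -[LHS]FracField.pi_mul; apply/eqmodP => /=.
rewrite FracField.equivfE /FracField.mulf !numden_Ratio ?mulr1 ?oner_neq0 //.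
by rewrite mulrC.
Qed.

Record fps (F : fieldType) : Type := Fps { fps_coef : nat -> F }.

Section PowerSeries.
Variable F : fieldType.
Implicit Types p q r : fps F.

Local Notation coef := fps_coef.

Lemma fps_ext p q : (forall k, coef p k = coef q k) -> p = q.
Proof. by case: p q => [p] [q] /= /funext ->. Qed.

HB.instance Definition _ := gen_eqMixin (fps F).
HB.instance Definition _ := gen_choiceMixin (fps F).

Definition fps_add p q := Fps (fun k => coef p k + coef q k).
Definition fps_opp p := Fps (fun k => - coef p k).
Definition fps_mul p q :=
  Fps (fun k => \sum_(l < k.+1) coef p l * coef q (k - l)).

Definition poly_fps (a : {poly F}) : fps F := Fps (fun k => a`_k).

Fact fps_addA : associative fps_add.
Proof. by move=> p q r; apply: fps_ext => k /=; rewrite addrA. Qed.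
Fact fps_addC : commutative fps_add.
Proof. by move=> p q; apply: fps_ext => k /=; rewrite addrC. Qed.
Fact fps_add0 : left_id (poly_fps 0) fps_add.
Proof. by move=> p; apply: fps_ext => k /=; rewrite coef0 add0r. Qed.
Fact fps_addN : left_inverse (poly_fps 0) fps_opp fps_add.
Proof. by move=> p; apply: fps_ext => k /=; rewrite coef0 addNr. Qed.

HB.instance Definition _ :=
  GRing.isZmodule.Build (fps F) fps_addA fps_addC fps_add0 fps_addN.

Let trunc N p : {poly F} := \poly_(k < N.+1) coef p k.

Let coef_trunc N p k : (k <= N)%N -> (trunc N p)`_k = coef p k.
Proof. by move=> kN; rewrite coef_poly ltnS kN. Qed.

Let coef_mul_trunc N p q k : (k <= N)%N ->
  coef (fps_mul p q) k = (trunc N p * trunc N q)`_k.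
Proof.
move=> kN; rewrite coefM /=; apply: eq_bigr => l _.
have lk : (l <= k)%N by rewrite -ltnS.
by rewrite !coef_trunc // ?(leq_trans _ kN) // leq_subr.
Qed.

Let trunc_mul N p q k : (k <= N)%N ->
  (trunc N (fps_mul p q))`_k = (trunc N p * trunc N q)`_k.
Proof. by move=> kN; rewrite coef_trunc // (@coef_mul_trunc N). Qed.

Fact fps_mulA : associative fps_mul.
Proof.
move=> p q r; apply: fps_ext => k.
rewrite !(@coef_mul_trunc k _ _ k) //.
transitivity ((trunc k p * (trunc k q * trunc k r))`_k).
  rewrite !coefM; apply: eq_bigr => l _.
  by rewrite trunc_mul ?leq_subr.
rewrite mulrA !coefM; apply: eq_bigr => l _.
by rewrite trunc_mul // -ltnS.
Qed.

Fact fps_mulC : commutative fps_mul.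
Proof.
by move=> p q; apply: fps_ext => k; rewrite !(@coef_mul_trunc k _ _ k) // mulrC.
Qed.

Fact fps_mul1 : left_id (poly_fps 1) fps_mul.
Proof.
move=> p; apply: fps_ext => k /=.
rewrite big_ord_recl coef1 eqxx mul1r subn0 big1 ?addr0 // => l _.
by rewrite coef1 mul0r.
Qed.

Fact fps_mulDl : left_distributive fps_mul fps_add.
Proof.
move=> p q r; apply: fps_ext => k /=.
by rewrite -big_split /=; apply: eq_bigr => l _; rewrite mulrDl.
Qed.

Fact fps_1neq0 : poly_fps 1 != 0.
Proof.
apply/eqP => /(congr1 (fun p => coef p 0)) /=.
by rewrite coef1 coef0 /=; apply/eqP; rewrite oner_eq0.
Qed.

HB.instance Definition _ := GRing.Zmodule_isComNzRing.Build (fps F)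
  fps_mulA fps_mulC fps_mul1 fps_mulDl fps_1neq0.

Definition fps_unit : pred (fps F) := fun p => `[< exists q, q * p = 1 >].
Definition fps_inv p : fps F :=
  if pselect (exists q, q * p = 1) is left pU then projT1 (cid pU) else p.

Fact fps_mulV : {in fps_unit, left_inverse 1 fps_inv *%R}.
Proof.
move=> p /asboolP pU; rewrite /fps_inv.
by case: pselect => // pU'; case: (cid pU').
Qed.
Fact fps_unitPl p q : q * p = 1 -> fps_unit p.
Proof. by move=> qp; apply/asboolP; exists q. Qed.
Fact fps_inv_out : {in [predC fps_unit], fps_inv =1 id}.
Proof.
by move=> p /asboolP pU; rewrite /fps_inv; case: pselect.
Qed.

HB.instance Definition _ := GRing.ComNzRing_hasMulInverse.Build (fps F)
  fps_mulV fps_unitPl fps_inv_out.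

Let fps_order p : p != 0 ->
  exists2 d, coef p d != 0 & forall k, (k < d)%N -> coef p k = 0.
Proof.
move=> p0; have exd : exists d, coef p d != 0.
  apply: contrapT => pE; case/eqP: p0; apply: fps_ext => k.
  rewrite /= coef0; apply/eqP/negPn/negP => pk; case: pE; by exists k.
case: (ex_minnP exd) => d pd dmin; exists d => // k.
by apply: contraTeq => /dmin; rewrite leqNgt.
Qed.

Fact fps_integral : GRing.integral_domain_axiom (fps F).
Proof.
move=> p q pq0; apply: contrapT => /negP; rewrite negb_or => /andP[p0 q0].
have [d pd pmin] := fps_order p0; have [e qe qmin] := fps_order q0.
have := congr1 (fun s => coef s (d + e)) pq0.
rewrite [RHS]/= coef0 => /=.
have dlt : (d < (d + e).+1)%N by rewrite ltnS leq_addr.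
rewrite (bigD1 (Ordinal dlt)) //= addKn big1 ?addr0.
  by apply/eqP; rewrite mulf_neq0.
move=> l ld; have [lltd|] := ltnP l d; first by rewrite pmin ?mul0r.
rewrite leq_eqVlt => /orP[/eqP dl|dltl].
  by case/eqP: ld; apply/val_inj.
by rewrite qmin ?mulr0 // ltn_subLR ?ltn_add2r // -ltnS.
Qed.

HB.instance Definition _ :=
  GRing.ComUnitRing_isIntegral.Build (fps F) fps_integral.

Fact poly_fps_is_zmod_morphism : zmod_morphism poly_fps.
Proof. by move=> a b; apply: fps_ext => k; rewrite /= coefB. Qed.
Fact poly_fps_is_monoid_morphism : monoid_morphism poly_fps.
Proof. by split=> // a b; apply: fps_ext => k; rewrite /= coefM. Qed.

HB.instance Definition _ := GRing.isZmodMorphism.Build {poly F} (fps F)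
  poly_fps poly_fps_is_zmod_morphism.
HB.instance Definition _ := GRing.isMonoidMorphism.Build {poly F} (fps F)
  poly_fps poly_fps_is_monoid_morphism.

(** The field embedding of [F(z)] into the fraction field of [F[[z]]]. *)
Definition ratfun_fps (x : {fraction {poly F}}) : {fraction fps F} :=
  (poly_fps (frac (repr x)).1)%:F / (poly_fps (frac (repr x)).2)%:F.

Lemma poly_fps_eq0 (a : {poly F}) : (poly_fps a == 0) = (a == 0).
Proof.
apply/eqP/eqP => [a0|->]; last exact: rmorph0.
by apply/polyP => k; have := congr1 (fun s => coef s k) a0.
Qed.

Lemma ratfun_fpsE (a b : {poly F}) : b != 0 ->
  ratfun_fps (a%:F / b%:F) = (poly_fps a)%:F / (poly_fps b)%:F.
Proof.
move=> b0; set x := a%:F / b%:F; rewrite /ratfun_fps.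
have d0 : (frac (repr x)).2 != 0 by exact: denom_ratioP.
apply/eqP; rewrite eqr_div ?tofrac_eq0 ?poly_fps_eq0 //.
rewrite -!tofracM tofrac_eq -!(rmorphM poly_fps); apply/eqP; congr poly_fps.
apply/eqP; rewrite -tofrac_eq !tofracM -fraction_numden -/x mulrAC.
by rewrite /x divfK ?tofrac_eq0.
Qed.

End PowerSeries.

Arguments poly_fps {F}.
Arguments ratfun_fps {F}.

Definition is_ideal (A : comNzRingType) (I : set A) : Prop :=
  [/\ I 0, forall x y, I x -> I y -> I (x + y) & forall a x, I x -> I (a * x)].

Definition ideal_gen (A : comNzRingType) (X : set A) : set A :=
  smallest (@is_ideal A) X.

(** The point [(1, v_1, ..., v_n)]. *)
Definition cons1 (A : nzRingType) (n : nat) (v : 'I_n -> A) (k : 'I_n.+1) : A :=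
  oapp v 1 (unlift ord0 k).

Section Homogenization.
Context {A : comNzRingType} {n : nat}.

Definition homogeneous m (Q : mpoly.mpoly m A) : Prop :=
  exists d : nat, Q \is mpoly.ishomog1 d (@mpoly.mdeg m).

Definition dehomogenize (Q : mpoly.mpoly n.+1 A) : mpoly.mpoly n A :=
  mpoly.mmap (@mpoly.mpolyC n A)
    (cons1 (fun k => mpoly.mpolyX A (mpoly.mnm1 k))) Q.

Definition homogenize (q : set (mpoly.mpoly n A)) : set (mpoly.mpoly n.+1 A) :=
  ideal_gen [set Q | homogeneous Q /\ q (dehomogenize Q)].

End Homogenization.

Section Relations.
Context {F : fieldType} {n : nat}.

Definition function_relations (f : 'I_n -> fps F) :
    set (mpoly.mpoly n {fraction {poly F}}) :=
  [set Q | mpoly.mmap ratfun_fps (fun k => (f k)%:F) Q = 0].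

Definition value_relations (L : fieldType) (j : F -> L) (v : 'I_n -> L) :
    set (mpoly.mpoly n F) :=
  [set P | mpoly.mmap j v P = 0].

(** The intersection of an ideal of [F(z)[X]] with [F[z][X]]. *)
Definition contract_to_poly (I : set (mpoly.mpoly n {fraction {poly F}})) :
    set (mpoly.mpoly n {poly F}) :=
  [set Q | I (mpoly.map_mpoly (@FracField.tofrac {poly F}) Q)].

Definition ev (alpha : F) (Q : mpoly.mpoly n {poly F}) : mpoly.mpoly n F :=
  mpoly.map_mpoly (horner_eval alpha) Q.

(** The subfield [F(z)(f_1, ..., f_n)] of the fraction field of [F[[z]]]. *)
Definition function_field (f : 'I_n -> fps F) : set {fraction fps F} :=
  subfield_gen
    (range ratfun_fps `|` range (fun k => (f k)%:F)).

End Relations.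

(* Main.v *)
From HB Require Import structures.
Require Import Defs.
From mathcomp Require Import all_boot all_order all_algebra all_field.
From mathcomp Require Import (canonicals, coercions) mpoly.
From mathcomp Require Import all_classical all_reals.
From mathcomp Require Import topology normedtype sequences.
From mathcomp Require Import ring lra zify.

Set Implicit Arguments.
Unset Strict Implicit.
Unset Printing Implicit Defensive.

Import Order.TTheory GRing.Theory Num.Theory.
Import numFieldNormedType.Exports.

Local Open Scope classical_set_scope.
Local Open Scope ring_scope.

(** Write [k] for [Kbar] and [S] for the graded ring generated over [k[z]] by the
    series [1, f_1, ..., f_n] placed in degree 1.  Analytic continuation gives one
    inclusion: relations between the functions specialize to relations
    between the values.  Suppose that all homogeneous relations between the values
    lift, so that an element of [S] whose value at [alpha] vanishes is divisible
    by [z - alpha] in [S].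

    Let [x = a / b] be algebraic over [k(z)], with [a, b] in the same graded piece
    of [S].  Specializing a primitive equation of [x] at [alpha] yields a nonzero
    binary form over [k] that vanishes at the values of [a] and [b]; since it
    splits, some nontrivial combination of [a] and [b] over [k] is divisible by
    [z - alpha].  If [x] is not in [k(z)], then [a] and [b] are independent over
    [k(z)], and replacing one of them by the quotient gives another such pair.
    This cannot go on for ever: the graded piece is a finitely generated
    [k[z]]-module, and a nonzero 2x2 minor of the coordinates of [(a, b)] loses
    the factor [z - alpha] at each step.  So [k(z)] is algebraically closed in the
    function field.

    Separability holds without any assumption.  In characteristic p, a relation
    [P(z, f) = 0] whose partial derivatives vanish identically is of the form
    [sum_(i < p) z^i Q_i(z, f)^p = 0], as [k] is perfect; since [1, ..., z^(p-1)]
    are independent over the p-th powers of [k((z))], each [Q_i(z, f)] vanishes,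
    and these relations have smaller degree.  Hence a relation of minimal degree
    exhibits one of the series as a simple root over the others, and MacLane's
    exchange argument gives a separating transcendence basis. *)

(** * Separable elements over a subfield *)

(** Bundling a subset with its closure properties makes [sf_type] a field, so that the theory of
    polynomials over a field applies to it. *)
Record sfield (M : fieldType) := SField
  { sf_set :> set M ; sf_ax : is_subfield sf_set }.
Definition sf_mem (M : fieldType) (S : sfield M) : {pred M} := mem (sf_set S).
Fact sf_closed (M : fieldType) (S : sfield M) : divring_closed (sf_mem S).
Proof. exact: sf_ax. Qed.
HB.instance Definition _ (M : fieldType) (S : sfield M) :=
  GRing.isDivringClosed.Build M (sf_mem S) (sf_closed S).
Record sf_type (M : fieldType) (S : sfield M) :=
  SfType { sf_val : M ; _ : sf_val \in sf_mem S }.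
HB.instance Definition _ (M : fieldType) (S : sfield M) :=
  [isSub for @sf_val M S].
HB.instance Definition _ (M : fieldType) (S : sfield M) :=
  [Choice of sf_type S by <:].
HB.instance Definition _ (M : fieldType) (S : sfield M) :=
  [SubChoice_isSubIntegralDomain of sf_type S by <:].
HB.instance Definition _ (M : fieldType) (S : sfield M) :=
  [SubIntegralDomain_isSubField of sf_type S by <:].

Section Subfields.
Variable M : fieldType.
Implicit Types (S X Y : set M) (x y : M).

Lemma is_subfieldP S : is_subfield S <->
  [/\ S 1, forall x y, S x -> S y -> S (x - y) &
      forall x y, S x -> S y -> S (x / y)].
Proof.
split=> [[S1 SB SD]|[S1 SB SD]].
  split; first by have := S1; rewrite inE.
  - by move=> x y Sx Sy; have := SB x y; rewrite !inE; apply.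
  by move=> x y Sx Sy; have := SD x y; rewrite !inE; apply.
by split=> [|x y|x y]; rewrite !inE; [|apply: SB|apply: SD].
Qed.

Lemma subfield_genP X : is_subfield (subfield_gen X).
Proof.
apply/is_subfieldP; split.
- by move=> A [/is_subfieldP[]].
- move=> x y Xx Xy A AX; have /is_subfieldP[_ AB _] := AX.1.
  exact: AB (Xx A AX) (Xy A AX).
- move=> x y Xx Xy A AX; have /is_subfieldP[_ _ AD] := AX.1.
  exact: AD (Xx A AX) (Xy A AX).
Qed.

Lemma sub_subfield_gen X : X `<=` subfield_gen X.
Proof. exact: sub_gen_smallest. Qed.

Lemma subfield_gen_sub X S :
  is_subfield S -> X `<=` S -> subfield_gen X `<=` S.
Proof. exact: smallest_sub. Qed.

Lemma is_subfield_image (L : fieldType) (phi : {rmorphism L -> M})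
    (E : {pred L}) : GRing.divring_closed E ->
  is_subfield (phi @` [set` E]).
Proof.
move=> [E1 EB ED]; apply/is_subfieldP; split.
- by exists 1; rewrite ?rmorph1.
- by move=> _ _ [a Ea <-] [b Eb <-]; exists (a - b); rewrite ?rmorphB //; apply: EB.
- by move=> _ _ [a Ea <-] [b Eb <-]; exists (a / b); rewrite ?fmorph_div //; apply: ED.
Qed.

End Subfields.

Section SubfieldType.
Variables (M : fieldType) (S : sfield M).
Local Notation iota := (val : sf_type S -> M).

Lemma sf_valP (a : sf_type S) : sf_set S (iota a).
Proof. by have := valP a; rewrite inE. Qed.

Lemma sf_lift x : sf_set S x -> exists a, iota a = x.
Proof. by rewrite -[sf_set S x]in_setE => Sx; exists (SfType Sx). Qed.

Lemma polyOver_memP (p : {poly M}) :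
  p \is a polyOver (mem (sf_set S)) <-> forall i, sf_set S p`_i.
Proof.
split=> [pS i|pS].
  by have /polyOverP/(_ i) : p \is a polyOver (sf_mem S) := pS; rewrite inE.
suff : p \is a polyOver (sf_mem S) by [].
by apply/polyOverP => i; rewrite inE.
Qed.

Lemma polyOver_lift (p : {poly M}) : p \is a polyOver (mem (sf_set S)) ->
  exists q : {poly sf_type S}, p = map_poly iota q.
Proof.
move=> /polyOver_memP pS; exists (\poly_(i < size p) insubd 0 p`_i).
apply/polyP => i; rewrite coef_map coef_poly; case: ltnP => ip /=.
  by rewrite insubdK // inE.
by rewrite nth_default.
Qed.

Lemma polyOver_map_val (q : {poly sf_type S}) :
  map_poly iota q \is a polyOver (mem (sf_set S)).
Proof. by apply/polyOver_memP => i; rewrite coef_map; apply: sf_valP. Qed.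

Lemma separable_overP x : separable_over (sf_set S) x <->
  exists2 q, separable_poly q & root (map_poly iota q) x.
Proof.
split=> [[p [/polyOver_lift[q ->] q0 qx]]|[q q0 qx]].
  by exists q => //; rewrite -(separable_map iota).
by exists (map_poly iota q); rewrite polyOver_map_val separable_map.
Qed.

Lemma separable_over_base x : sf_set S x -> separable_over (sf_set S) x.
Proof.
move=> /sf_lift[a <-]; apply/separable_overP; exists ('X - a%:P).
  by rewrite unlock !derivCE coprimep1.
by rewrite map_polyXsubC root_XsubC.
Qed.

(* In characteristic p, dividing by [gcdp q q^`()] removes all the inseparable
   factors of [q] altogether, but keeps its simple roots. *)
Lemma separable_over_simple_root (h : {poly M}) x :
  h \is a polyOver (mem (sf_set S)) -> root h x -> ~~ root h^`() x ->
  separable_over (sf_set S) x.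
Proof.
move=> /polyOver_lift[q ->]; rewrite deriv_map => qx q'x.
have q0 : q != 0 by apply: contraNneq q'x => ->; rewrite linear0 rmorph0 root0.
apply/separable_overP; exists (q %/ gcdp q q^`()); first exact: make_separable.
have gx : ~~ root (map_poly iota (gcdp q q^`())) x.
  apply: contra q'x => gx; have /dvdpP[r ->] := dvdp_gcdr q q^`().
  by rewrite rmorphM rootM gx orbT.
move: qx; rewrite -{1}[q](@divpK _ (gcdp q q^`())) ?dvdp_gcdl //.
by rewrite rmorphM rootM (negPf gx) orbF.
Qed.

End SubfieldType.

(** By the primitive element theorem [x] and [y] lie in [F(z)] for a single [z], which is realized
    as a finite extension [L] with its linear algebra. The first hypothesis amounts to [F] being
    infinite. *)
Lemma two_generator_extension (F M : fieldType) (iota : {rmorphism F -> M})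
    (x y : M) (q : {poly F}) :
  (forall r : {poly M}, r != 0 -> exists t, ~~ root r (iota t)) ->
  separable_poly q -> root (map_poly iota q) x -> algebraicOver iota y ->
  exists (L : fieldExtType F) (phi : {rmorphism L -> M}) (x' y' : L),
    [/\ forall a, phi a%:A = iota a, phi x' = x & phi y' = y].
Proof.
move=> large q_sep qx algy; have [p p0 py] := algy.
have [r /large[t rt] /(_ t rt) /=] := large_field_PET p0 py qx q_sep.
set z := _ - _; move=> [[qy qyE] [qx' qxE]].
have algz : algebraicOver iota z.
  apply: algebraic_sub => //; apply: algebraic_mul; first exact: algebraic_id.
  by exists q => //; apply: separable_poly_neq0.
(* A nonzero polynomial of least size that kills [z] is irreducible. *)
have exm : exists m, `[< exists2 h, h != 0 /\ root (map_poly iota h) z & size h = m >].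
  by have [h h0 hz] := algz; exists (size h); apply/asboolP; exists h.
case: (ex_minnP exm) => m /asboolP[h [h0 hz] hm] min_m.
have h_irr : irreducible_poly h.
  apply/(subfx_irreducibleP hz h0) => g gz g0; rewrite hm; apply: min_m.
  by apply/asboolP; exists g.
exists (SubFieldExtType hz h_irr).
exists (subfx_inj : {rmorphism subFExtend iota z h -> M}).
exists (subfx_eval iota z h qx'), (subfx_eval iota z h qy); split.
- by move=> a; apply: subfx_inj_base.
- by rewrite /= subfx_inj_eval.
- by rewrite /= subfx_inj_eval.
Qed.

Section SeparableTower.
Variables (M : fieldType) (S : sfield M).
Hypothesis large : forall r : {poly M}, r != 0 -> exists2 t, sf_set S t & ~~ root r t.
Local Notation iota := (val : sf_type S -> M).

(** Both elements are moved into a finite extension [L] of [S], where separability is transitive;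
    the resulting polynomials are carried back to [M] by [phi]. *)
Lemma separable_tower (x y : M) :
  separable_over S x -> separable_over (subfield_gen (S `|` [set x])) y ->
  subfield_gen (S `|` [set x; y]) `<=` separable_over S.
Proof.
move=> /separable_overP[q q_sep qx] [g [gS g_sep gy]].
have algx : algebraicOver iota x by exists q => //; apply: separable_poly_neq0.
(* The coefficients of [g] lie in [S(x)], all of whose elements are algebraic over [S], hence so is
   the root [y]. *)
have algy : algebraicOver iota y.
  apply/integral_algebraic; apply: (@integral_root _ _ _ g) => //.
    exact: separable_poly_neq0.
  have sub : subfield_gen (S `|` [set x]) `<=` algebraicOver iota.
    apply: subfield_gen_sub.
      apply/is_subfieldP; split; first exact: algebraic1.
        exact: algebraic_sub.
      exact: algebraic_div.
    move=> w [/sf_lift[a <-]|->] //; exact: algebraic_id.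
  move=> c /(nthP 0)[i _ <-]; apply/integral_algebraic/sub.
  exact: (polyOver_memP (SField (subfield_genP _)) g).1.
have large' (r : {poly M}) : r != 0 -> exists t, ~~ root r (iota t).
  by move=> /large[t /sf_lift[a <-] rt]; exists a.
have [L [phi [x' [y' [phiE phix phiy]]]]] :=
  two_generator_extension large' q_sep qx algy.
have phi1 (s : M) : sf_set S s -> exists2 a, a \in 1%VS & phi a = s.
  by move=> /sf_lift[a <-]; exists a%:A; rewrite ?phiE // rpredZ ?mem1v.
have sep_x' : separable_element 1 x'.
  apply/separable_elementP; exists (map_poly (in_alg L) q); split.
  - by apply/polyOverP => i; rewrite coef_map /= rpredZ ?mem1v.
  - move: qx; rewrite -phix !rootE -(fmorph_eq0 phi) -horner_map -map_poly_comp.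
    by rewrite (@eq_map_poly _ _ (phi \o in_alg L) iota).
  - by rewrite separable_map.
have sub_x : subfield_gen (S `|` [set x]) `<=` phi @` [set` <<1; x'>>%AS].
  apply: subfield_gen_sub.
    by apply: is_subfield_image; exact: GRing.divringClosedP <<1; x'>>%AS.
  move=> w [/phi1[a a1 <-]|->].
    by exists a => //=; apply: subvP_adjoin.
  by exists x' => //=; apply: memv_adjoin.
have sep_y' : separable_element <<1; x'>> y'.
  (* The coefficients of [g] lie in [S(x)] and are pulled back to [L] one by one. *)
  have gL i : exists2 a, a \in <<1; x'>>%AS & phi a = g`_i.
    by apply: sub_x; have := (polyOver_memP (SField (subfield_genP _)) g).1 gS i.
  pose g' := \poly_(i < size g) s2val (cid2 (gL i)).
  have g'E : map_poly phi g' = g.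
    apply/polyP => i; rewrite coef_map coef_poly; case: ltnP => ig.
      by case: (cid2 _).
    by rewrite nth_default ?raddf0.
  apply/separable_elementP; exists g'; split.
  - apply/polyOverP => i; rewrite coef_poly; case: ltnP => _; last exact: rpred0.
    by case: (cid2 _).
  - by rewrite rootE -(fmorph_eq0 phi) -horner_map g'E phiy -rootE.
  - by rewrite -(separable_map phi) g'E.
have sep_L : separable 1 <<<<1; x'>>; y'>>.
  by apply: (@separable_trans _ _ <<1; x'>>%AS); rewrite -adjoin_separable_eq.
have sub_xy : subfield_gen (S `|` [set x; y])
    `<=` phi @` [set` <<<<1; x'>>; y'>>%AS].
  apply: subfield_gen_sub.
    apply: is_subfield_image; exact: GRing.divringClosedP <<<<1; x'>>; y'>>%AS.
  move=> w [/phi1[a a1 <-]|[->|->]].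
  - by exists a => //=; do 2! apply: subvP_adjoin.
  - by exists x' => //=; apply: subvP_adjoin; apply: memv_adjoin.
  - by exists y' => //=; apply: memv_adjoin.
move=> w /sub_xy[w' /(separableP sep_L)/separable_elementP[h [h1 hw h_sep]] <-].
exists (map_poly phi h); split.
- apply/polyOver_memP => i; rewrite coef_map /=.
  have /vlineP[a ->] := polyOverP h1 i.
  by rewrite phiE; apply: sf_valP.
- by rewrite separable_map.
- by rewrite rootE horner_map fmorph_eq0 -rootE.
Qed.

(** Differences and quotients of [x] and [y] lie in [S(x, y)], so the tower settles both once a
    polynomial over [S] is read as one over [S(x)]. *)
Lemma separable_over_subfield : is_subfield (separable_over S).
Proof.
apply/is_subfieldP.
have sub x y : separable_over S x -> separable_over S y ->
    subfield_gen (S `|` [set x; y]) `<=` separable_over S.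
  move=> Sx [g [gS g_sep gy]]; apply: separable_tower => //.
  exists g; split=> //; apply/(polyOver_memP (SField (subfield_genP _))) => i.
  apply: sub_subfield_gen; left; apply: (polyOver_memP S g).1 gS i.
have genl x y : subfield_gen (S `|` [set x; y]) x.
  by apply: sub_subfield_gen; right; left.
have genr x y : subfield_gen (S `|` [set x; y]) y.
  by apply: sub_subfield_gen; right; right.
have gen_f x y := subfield_genP (S `|` [set x; y]).
split.
- by apply: separable_over_base; have /is_subfieldP[] := sf_ax S.
- move=> x y Sx Sy; apply: (sub x y Sx Sy).
  have /is_subfieldP[_ B _] := gen_f x y; exact: B.
- move=> x y Sx Sy; apply: (sub x y Sx Sy).
  have /is_subfieldP[_ _ D] := gen_f x y; exact: D.
Qed.

Lemma separable_over_trans (x y : M) :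
  separable_over S x -> separable_over (subfield_gen (S `|` [set x])) y ->
  separable_over S y.
Proof.
move=> Sx Sy; apply: (separable_tower Sx Sy).
by apply: sub_subfield_gen; right; right.
Qed.
End SeparableTower.

(** * Power series in positive characteristic *)

Section PowerSeriesCoefficients.
Variable F : fieldType.
Implicit Types g h : fps F.

Lemma fps_coef_XnM d g k : fps_coef (poly_fps 'X^d * g) k =
  if (k < d)%N then 0 else fps_coef g (k - d).
Proof.
rewrite /=; case: ltnP => kd.
  rewrite big1 // => l _; rewrite coefXn.
  by rewrite ltn_eqF ?mul0r // (leq_ltn_trans _ kd) // -ltnS.
rewrite (bigD1 (Ordinal (kd : d < k.+1)%N)) //= coefXn eqxx mul1r.
rewrite big1 ?addr0 // => l /negPf ld; rewrite coefXn.
by rewrite -[l == _ :> nat]/(l == Ordinal (kd : d < k.+1)%N) ld mul0r.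
Qed.

Lemma fps_shift g : exists h, g = poly_fps (fps_coef g 0)%:P + poly_fps 'X * h.
Proof.
exists (Fps (fun k => fps_coef g k.+1)); apply: fps_ext => k.
rewrite [RHS]/= coefC -['X]expr1 -/(fps_coef (poly_fps 'X^1 * _) k).
have /= -> := fps_coef_XnM 1 (Fps (fun k => fps_coef g k.+1)) k.
by case: k => [|k] /=; rewrite ?addr0 // add0r subn1.
Qed.

Lemma poly_fps_inj : injective (@poly_fps F).
Proof.
by move=> a b ab; apply/polyP => k; have := congr1 (fun s => fps_coef s k) ab.
Qed.

Section Frobenius.
Variable p : nat.
Hypothesis pF : p \in [pchar F].

Let p_prime : prime p := pcharf_prime pF.
Let p_gt0 : (0 < p)%N := prime_gt0 p_prime.

Lemma fps_pchar : p \in [pchar fps F].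
Proof. exact: (rmorph_pchar (poly_fps \o polyC)). Qed.

Lemma mpoly_pchar n : p \in [pchar mpoly.mpoly n {poly F}].
Proof. exact: (rmorph_pchar (@mpoly.mpolyC n {poly F} \o polyC)). Qed.

Lemma poly_pchar : p \in [pchar {poly F}].
Proof. exact: (rmorph_pchar polyC). Qed.

(* The coefficients of index less than [p] only involve the constant terms. *)
Lemma fps_pbasis_shift (g : 'I_p -> fps F) :
  \sum_(i < p) poly_fps 'X^i * g i ^+ p = 0 ->
  exists2 h : 'I_p -> fps F, forall i, g i = poly_fps 'X * h i &
    \sum_(i < p) poly_fps 'X^i * h i ^+ p = 0.
Proof.
move=> g0; have [h gE] := choice (fun i => fps_shift (g i)).
pose c i := fps_coef (g i) 0.
(* With [g i = c i + z * h i], additivity of Frobenius gives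
   [g i ^+ p = c i ^+ p + z ^+ p * h i ^+ p]. *)
have sumE : \sum_(i < p) poly_fps 'X^i * g i ^+ p =
    poly_fps (\sum_(i < p) 'X^i * (c i ^+ p)%:P) +
    poly_fps 'X^p * \sum_(i < p) poly_fps 'X^i * h i ^+ p.
  rewrite rmorph_sum mulr_sumr -big_split /=; apply: eq_bigr => i _.
  rewrite {1}gE -/(c i) -(pFrobenius_autE fps_pchar) rmorphD /= !pFrobenius_autE.
  by rewrite exprMn -!rmorphXn /= polyC_exp mulrDr rmorphM mulrCA.
have c0 j : c j = 0.
  have := congr1 (fun s => fps_coef s j) g0; rewrite sumE.
  rewrite -[LHS]/(_ + fps_coef (poly_fps 'X^p * _) j) fps_coef_XnM ltn_ord addr0.
  rewrite /= coef_sum (bigD1 j) //= coefMC coefXn eqxx mul1r big1 => [|i ij].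
    by rewrite addr0 coef0 => /eqP; rewrite expf_eq0 p_gt0 => /eqP.
  by rewrite coefMC coefXn (negPf (_ : val j != val i)) ?mul0r // eq_sym.
exists h => [i|]; first by rewrite gE -/(c i) c0 rmorph0 add0r.
move: g0; rewrite sumE big1 => [|i _]; last first.
  by rewrite c0 expr0n gtn_eqF // mulr0.
rewrite rmorph0 add0r => /eqP; rewrite mulf_eq0 => /orP[|/eqP//].
by rewrite poly_fps_eq0 -size_poly_eq0 size_polyXn.
Qed.

(** The shifted family satisfies the same relation, and its coefficient of index [N - 1] is the one
    of index [N] of [g i]: induction on [N]. *)
Lemma fps_pbasis_free (g : 'I_p -> fps F) :
  \sum_(i < p) poly_fps 'X^i * g i ^+ p = 0 -> forall i, g i = 0.
Proof.
move=> g0 i; apply: fps_ext => N; rewrite [RHS]/= coef0.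
elim: N g g0 => [|N IHN] g /fps_pbasis_shift[h gE h0].
  by rewrite gE -['X]expr1 fps_coef_XnM.
by rewrite gE -['X]expr1 fps_coef_XnM /= subn1 /= (IHN h).
Qed.

Hypothesis F_closed : GRing.closed_field_axiom F.

Lemma pth_root_exists (a : F) : exists b, b ^+ p = a.
Proof.
have [b bE] := F_closed (fun i => if i == 0%N then a else 0) p_gt0.
exists b; rewrite bE; case: p p_gt0 => // q _.
by rewrite big_ord_recl /= mulr1 big1 ?addr0 // => i _; rewrite mul0r.
Qed.

(** If [b ^+ p] is the coefficient of index [j], the corresponding term equals
    ['X^(j %% p) * (b *: 'X^(j %/ p)) ^+ p]. *)
Lemma poly_pbasis (a : {poly F}) :
  exists d : 'I_p -> {poly F}, a = \sum_(i < p) 'X^i * d i ^+ p.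
Proof.
pose K c := exists d : 'I_p -> {poly F}, c = \sum_(i < p) 'X^i * d i ^+ p.
rewrite -[a]coefK poly_def; apply: (big_ind K) => [|_ _ [d ->] [e ->]|j _].
- by exists (fun=> 0); rewrite big1 // => i _; rewrite expr0n gtn_eqF // mulr0.
- exists (fun i => d i + e i); rewrite -big_split; apply: eq_bigr => i _ /=.
  by rewrite -!(pFrobenius_autE poly_pchar) rmorphD mulrDr.
have [b bE] := pth_root_exists a`_j.
pose i0 := Ordinal (ltn_pmod j p_gt0).
exists (fun i => if i == i0 then b *: 'X^(j %/ p) else 0).
rewrite (bigD1 i0) //= eqxx big1 => [|i /negPf ->]; last first.
  by rewrite expr0n gtn_eqF // mulr0.
rewrite addr0 exprZn bE -exprM -scalerAr -exprD addnC.
by rewrite -divn_eq.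
Qed.

(** The monomials are already [p]-th powers, so only the coefficients need decomposing. The degree
    bound feeds the induction of [separable_relation]. *)
Lemma mpoly_pbasis n (P : mpoly.mpoly n {poly F}) :
  (forall m i, m \in mpoly.msupp P -> (p %| m i)%N) ->
  exists2 Q : 'I_p -> mpoly.mpoly n {poly F},
    P = \sum_(i < p) mpoly.mpolyC n 'X^i * Q i ^+ p &
    forall i m, m \in mpoly.msupp (Q i) ->
      (mpoly.mdeg m * p < mpoly.mmeasure mpoly.mdeg P)%N.
Proof.
move=> Pp; pose K R := exists2 Q : 'I_p -> mpoly.mpoly n {poly F},
    R = \sum_(i < p) mpoly.mpolyC n 'X^i * Q i ^+ p &
    forall i m, m \in mpoly.msupp (Q i) ->
      (mpoly.mdeg m * p < mpoly.mmeasure mpoly.mdeg P)%N.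
suff : K P by []; rewrite [X in K X]mpoly.mpolyE big_seq.
apply: (big_ind K) => [|_ _ [d -> dB] [e -> eB]|m mP].
- exists (fun=> 0) => [|i m]; last by rewrite mpoly.msupp0.
  by rewrite big1 // => i _; rewrite expr0n gtn_eqF // mulr0.
- exists (fun i => d i + e i) => [|i m].
    rewrite -big_split; apply: eq_bigr => i _ /=.
    by rewrite -!(pFrobenius_autE (mpoly_pchar n)) rmorphD mulrDr.
  by move=> /mpoly.msuppD_le; rewrite mem_cat => /orP[/dB|/eB].
have [d dE] := poly_pbasis (mpoly.mcoeff m P).
pose m' := mpoly.Multinom [tuple (m i %/ p)%N | i < n].
have mE : m = mpoly.mnm_muln m' p.
  by apply/mpoly.mnmP => i; rewrite mpoly.mulmnE mpoly.mnmE divnK // Pp.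
exists (fun i => d i *: mpoly.mpolyX _ m') => [|i m1]; last first.
  move=> /mpoly.msuppZ_le; rewrite mpoly.msuppX inE => /eqP ->.
  by rewrite -mpoly.mdegMn -mE; apply: mpoly.msize_mdeg_lt.
rewrite {1}dE scaler_suml; apply: eq_bigr => i _.
by rewrite exprZn mpoly.mpolyXn -mE mpoly.mul_mpolyC scalerA.
Qed.

End Frobenius.

Lemma separable_relation n (t : 'I_n -> fps F) :
  GRing.closed_field_axiom F ->
  (exists2 P : mpoly.mpoly n {poly F}, P != 0 & mpoly.mmap poly_fps t P = 0) ->
  exists P i, mpoly.mmap poly_fps t P = 0 /\ mpoly.mmap poly_fps t (mpoly.mderiv i P) != 0.
Proof.
move=> F_closed [P0 P0_neq0 tP0]; apply: contrapT => no_rel.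
have deriv0 (P : mpoly.mpoly n {poly F}) i : mpoly.mmap poly_fps t P = 0 ->
    mpoly.mmap poly_fps t (mpoly.mderiv i P) = 0.
  move=> tP; apply/eqP/negPn/negP => tP'.
  by apply: no_rel; exists P, i; split.
(* If derivatives of relations are again relations, then every relation is zero, by induction on its
   size, the degree plus one. *)
suff free N (P : mpoly.mpoly n {poly F}) : (mpoly.mmeasure mpoly.mdeg P <= N)%N ->
    mpoly.mmap poly_fps t P = 0 -> P = 0.
  by case/eqP: P0_neq0; apply: free (leqnn _) tP0.
elim: N P => [|N IHN] P PN tP.
  by apply/eqP; rewrite -(mpoly.msize_poly_eq0 P) -leqn0.
have [P0E|P_neq0] := eqVneq P 0 => //.
have P'0 i : mpoly.mderiv i P = 0.
  apply: IHN (deriv0 _ _ tP); rewrite -ltnS; apply: leq_trans PN.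
  have P_gt0 : (0 < mpoly.mmeasure mpoly.mdeg P)%N.
    by rewrite lt0n mpoly.msize_poly_eq0.
  rewrite -(prednK P_gt0) ltnS mpoly.msizeE; apply/bigmax_leqP_seq => m.
  rewrite mpoly.mcoeff_msupp mpoly.mcoeff_mderiv => Pm _.
  have : mpoly.mnm_add m (mpoly.mnm1 i) \in mpoly.msupp P.
    by rewrite mpoly.mcoeff_msupp; apply: contraNneq Pm => ->; rewrite mul0rn.
  by move=> /mpoly.msize_mdeg_lt; rewrite mpoly.mdegD mpoly.mdeg1 addn1; lia.
have aux (c : {poly F}) k : c != 0 -> c *+ k = 0 -> k%:R = 0 :> F.
  move=> c0 ck; apply: (@polyC_inj F); apply/eqP.
  by rewrite rmorph_nat rmorph0 -(mulrI_eq0 _ (mulfI c0)) mulr_natr ck.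
(* The vanishing derivatives force every exponent of [P] to be zero in [F]; below, a nonzero
   exponent makes the characteristic a prime dividing them all. *)
have Pchar m i : m \in mpoly.msupp P -> (m i)%:R = 0 :> F.
  move=> mP; have [->//|mi] := eqVneq (m i) 0%N.
  have cm : (mpoly.mcoeff m P : {poly F}) *+ m i = 0.
    have := congr1 (mpoly.mcoeff (mpoly.mnm_sub m (mpoly.mnm1 i))) (P'0 i).
    rewrite mpoly.mcoeff_mderiv mpoly.submK ?mpoly.lep1mP // mpoly.mnmBE.
    by rewrite mpoly.mnm1E eqxx subn1 prednK ?lt0n // mpoly.mcoeff0.
  by move: mP; rewrite mpoly.mcoeff_msupp => /aux; apply.
have [P1|P1] := leqP (mpoly.mmeasure mpoly.mdeg P) 1.
  move: tP; rewrite (mpoly.msize1_polyC P1) mpoly.mmapC => /eqP.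
  by rewrite poly_fps_eq0 => /eqP ->; rewrite rmorph0.
have [m mP [i mi]] : exists2 m, m \in mpoly.msupp P & exists i, m i != 0%N.
  apply: contrapT => noM; move: P1; rewrite ltnNge mpoly.msizeE; case/negP.
  apply/bigmax_leqP_seq => m mP _; rewrite ltnS leqn0 mpoly.mdeg_eq0.
  apply/eqP/mpoly.mnmP => i; rewrite mpoly.mnm0E; apply/eqP/negPn/negP => mi.
  by apply: noM; exists m => //; exists i.
have [p [p_gt0 pF]] : exists p, (0 < p)%N /\ p \in [pchar F].
  have mi_gt0 : (0 < m i)%N by rewrite lt0n.
  have [p pF] := natf0_pchar mi_gt0 (introT eqP (Pchar m i mP)).
  by exists p; split=> //; apply/prime_gt0/(pcharf_prime pF).
have Pp m' i' : m' \in mpoly.msupp P -> (p %| m' i')%N.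
  by move=> /Pchar mi0; rewrite (dvdn_pcharf pF) mi0.
have [Q PE QB] := mpoly_pbasis pF F_closed Pp.
(* As [p] is at least 2 and [P] is not constant, each [Q l] is smaller than [P]; it is a relation
   because the powers of [z] below [p] are free over the [p]-th powers. *)
have Q0 l : Q l = 0.
  apply: IHN.
    rewrite mpoly.msizeE; apply/bigmax_leqP_seq => m1 m1Q _.
    have := QB _ _ m1Q; have := prime_gt1 (pcharf_prime pF).
    by move: P1 PN; move: (mpoly.mdeg _) (mpoly.mmeasure _ _) => d e; nia.
  apply: (@fps_pbasis_free p pF (fun l => mpoly.mmap poly_fps t (Q l))).
  rewrite -[RHS]tP [in RHS]PE rmorph_sum; apply: eq_bigr => l' _.
  rewrite rmorphM /= mpoly.mmapC; congr (_ * _).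
  exact/esym/(rmorphXn (mpoly.mmap poly_fps t)).
by rewrite PE big1 // => l _; rewrite Q0 expr0n gtn_eqF // mulr0.
Qed.

End PowerSeriesCoefficients.

(** * Power series over a valued field *)

Section AbsoluteValue.
Variables (R : realType) (L : valuedFieldType R).
Implicit Types (x y l w a : L) (c d : fps L).

Lemma absv0 : absv (0 : L) = 0 :> R.
Proof. by apply/eqP; rewrite absv_eq0. Qed.

Lemma absv1 : absv (1 : L) = 1 :> R.
Proof.
have a1 : absv (1 : L) != 0 :> R by rewrite absv_eq0 oner_eq0.
by apply: (mulfI a1); rewrite -absvM !mulr1.
Qed.

Lemma absvX x n : absv (x ^+ n) = absv x ^+ n :> R.
Proof. by elim: n => [|n IHn]; rewrite ?expr0 ?absv1 // !exprS absvM IHn. Qed.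

Lemma absvN x : absv (- x) = absv x :> R.
Proof.
have : absv (-1 : L) ^+ 2 = 1 :> R by rewrite -absvX sqrrN expr1n absv1.
move/eqP; rewrite sqrp_eq1 ?absv_ge0 // => /eqP a1.
by rewrite -mulN1r absvM a1 mul1r.
Qed.

Lemma absv_distC x y : absv (x - y) = absv (y - x) :> R.
Proof. by rewrite -absvN opprB. Qed.

Lemma absvV x : absv x^-1 = (absv x)^-1 :> R.
Proof.
have [->|x0] := eqVneq x 0; first by rewrite invr0 absv0 invr0.
have ax : absv x != 0 :> R by rewrite absv_eq0.
by apply: (mulfI ax); rewrite -absvM !mulfV // absv1.
Qed.

Lemma absv_sum I (r : seq I) (P : pred I) (F : I -> L) :
  absv (\sum_(i <- r | P i) F i) <= \sum_(i <- r | P i) absv (F i) :> R.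
Proof.
apply: (big_ind2 (fun x (s : R) => absv x <= s)) => //; first by rewrite absv0.
by move=> x s y t xs yt; apply: le_trans (absvD _ _) _; apply: lerD.
Qed.

Lemma nbhs_absvP x (P : set L) :
  nbhs x P <-> exists2 e : R, 0 < e & forall y, absv (y - x) < e -> P y.
Proof.
rewrite nbhs_ballP; split=> -[e e0 eP]; exists e => // y.
  by move=> yx; apply: eP; rewrite ballEmdist /= mdist_absv absv_distC.
by rewrite ballEmdist /= mdist_absv absv_distC; apply: eP.
Qed.

(** Reduces limits in [L] to limits of real sequences, where sums, products and squeezing are
    available. *)
Lemma cvg_absvP (u : nat -> L) l :
  u @ \oo --> l <-> (fun n => absv (u n - l) : R) @ \oo --> (0 : R).
Proof.
split=> [ul|ul].
  apply/cvgr0Pnorm_lt => e e0.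
  have /ul : nbhs l [set y | absv (y - l) < e] by apply/nbhs_absvP; exists e.
  move=> H; near=> n; rewrite ger0_norm ?absv_ge0 //.
  by near: n; apply: H.
move=> A /nbhs_absvP[e e0 eA].
move/cvgr0Pnorm_lt: ul => /(_ e e0) H.
near=> n; apply: eA; rewrite -[ltLHS]ger0_norm ?absv_ge0 //.
by near: n; apply: H.
Unshelve. all: by end_near. Qed.

Lemma absv_cvg_unique (u : nat -> L) l l' :
  u @ \oo --> l -> u @ \oo --> l' -> l = l'.
Proof.
move=> /cvg_absvP ul /cvg_absvP ul'; apply/eqP; rewrite -subr_eq0 -absv_eq0.
have H : (fun n => absv (u n - l) + absv (u n - l') : R) @ \oo --> (0 + 0 : R).
  exact: cvgD.
rewrite eq_le absv_ge0 andbT -[leRHS](addr0 0) -(cvg_lim _ H) //.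
apply: limr_ge; first by apply: cvgP H.
near=> n; rewrite (_ : l - l' = (u n - l') - (u n - l)); last by ring.
by apply: le_trans (absvD _ _) _; rewrite absvN addrC.
Unshelve. all: by end_near. Qed.

(** * Partial sums and Cauchy products *)

Definition psums c w (N : nat) : L := \sum_(m < N) fps_coef c m * w ^+ m.

Definition sums_to c w l := psums c w @ \oo --> l.

Lemma seriesE (c : nat -> L) w :
  series (fun m => c m * w ^+ m) = psums (Fps c) w.
Proof. by apply/funext => N; rewrite /series /= big_mkord. Qed.

Lemma sums_toD c d w l l' :
  sums_to c w l -> sums_to d w l' -> sums_to (c + d) w (l + l').
Proof.
move=> /cvg_absvP cl /cvg_absvP dl; apply/cvg_absvP.
have H : (fun n => absv (psums c w n - l) + absv (psums d w n - l') : R) @ \oo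
    --> (0 + 0 : R) by apply: cvgD.
rewrite addr0 in H; apply: squeeze_cvgr (@cvg_cst _ (0 : R) _ _ _) H.
near=> n; rewrite absv_ge0 /=.
rewrite (_ : psums (c + d) w n = psums c w n + psums d w n).
  by rewrite opprD addrACA absvD.
by rewrite -big_split; apply: eq_bigr => m _ /=; rewrite -mulrDl.
Unshelve. all: by end_near. Qed.

Lemma sums_to_poly (p : {poly L}) w : sums_to (poly_fps p) w p.[w].
Proof.
apply: cvg_near_cst; near=> n.
rewrite (@horner_coef_wide _ n) //; near: n; exact: nbhs_infty_ge.
Unshelve. all: by end_near. Qed.

Lemma triangular_sum (F : nat -> nat -> L) N :
  \sum_(m < N) \sum_(l < m.+1) F l (m - l)%N =
  \sum_(i < N) \sum_(0 <= j < N - i) F i j.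
Proof.
elim: N => [|N IHN]; first by rewrite !big_ord0.
rewrite big_ord_recr /= IHN [RHS]big_ord_recr /= big_ord_recr /= addrA.
rewrite subSn // subnn big_nat1; congr (_ + _).
rewrite -big_split; apply: eq_bigr => i _ /=.
by rewrite subSn ?big_nat_recr //= ltnW.
Qed.

(** The terms whose indices add up to at least [N]: they separate the product of two partial sums
    from the partial sum of the Cauchy product. *)
Definition cauchy_tail c d w N : L := \sum_(i < N) \sum_(N - i <= j < N)
  (fps_coef c i * w ^+ i) * (fps_coef d j * w ^+ j).

Lemma psumsM c d w N :
  psums c w N * psums d w N = psums (c * d) w N + cauchy_tail c d w N.
Proof.
have -> : psums (c * d) w N = \sum_(i < N) \sum_(0 <= j < N - i)
    (fps_coef c i * w ^+ i) * (fps_coef d j * w ^+ j).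
  rewrite -(triangular_sum (fun i j =>
    (fps_coef c i * w ^+ i) * (fps_coef d j * w ^+ j))).
  apply: eq_bigr => m _; rewrite /= mulr_suml; apply: eq_bigr => l _.
  by rewrite mulrACA -exprD subnKC // -ltnS.
rewrite -big_split /psums mulr_suml; apply: eq_bigr => i _ /=.
rewrite -big_cat_nat ?leq_subr //= mulr_sumr big_mkord.
by apply: eq_bigr.
Qed.

(** Convergence of both series does not by itself give that of their product, hence the condition on
    the tail, met for different reasons in the ultrametric and the archimedean case. *)
Lemma sums_toM c d w l l' : sums_to c w l -> sums_to d w l' ->
  cauchy_tail c d w @ \oo --> (0 : L) -> sums_to (c * d) w (l * l').
Proof.
move=> /cvg_absvP cl /cvg_absvP dl /cvg_absvP tl; apply/cvg_absvP.
have H : (fun n => absv (psums c w n - l) * absv (psums d w n - l') +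
    absv l * absv (psums d w n - l') + absv l' * absv (psums c w n - l) +
    absv (cauchy_tail c d w n - 0) : R) @ \oo
    --> (0 * 0 + absv l * 0 + absv l' * 0 + 0 : R).
  apply: cvgD => //; apply: cvgD; first apply: cvgD.
  - exact: cvgM.
  - by apply: cvgM => //; apply: cvg_cst.
  - by apply: cvgM => //; apply: cvg_cst.
rewrite !mulr0 !addr0 in H; apply: squeeze_cvgr (@cvg_cst _ (0 : R) _ _ _) H.
near=> n; rewrite absv_ge0 /= subr0.
have -> : psums (c * d) w n - l * l' =
    (psums c w n - l) * (psums d w n - l') + l * (psums d w n - l') +
    l' * (psums c w n - l) - cauchy_tail c d w n.
  have -> : psums (c * d) w n = psums c w n * psums d w n - cauchy_tail c d w n.
    by rewrite psumsM addrK.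
  by ring.
rewrite -!absvM -(absvN (cauchy_tail _ _ _ _)).
by do 2! (apply: le_trans (absvD _ _) _; rewrite lerD2r); apply: absvD.
Unshelve. all: by end_near. Qed.

Lemma sums_to_term c w l :
  sums_to c w l -> (fun m => fps_coef c m * w ^+ m) @ \oo --> (0 : L).
Proof.
move=> /cvg_absvP cl; apply/cvg_absvP.
have cl' := cl; rewrite -cvg_shiftS in cl'.
have H : (fun n => absv (psums c w n.+1 - l) + absv (psums c w n - l) : R) @ \oo
    --> (0 + 0 : R) by apply: cvgD.
rewrite addr0 in H; apply: squeeze_cvgr (@cvg_cst _ (0 : R) _ _ _) H.
near=> n; rewrite absv_ge0 /= subr0.
rewrite (_ : _ * _ = (psums c w n.+1 - l) - (psums c w n - l)).
  by apply: le_trans (absvD _ _) _; rewrite absvN.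
by rewrite /psums big_ord_recr /=; ring.
Unshelve. all: by end_near. Qed.

Lemma sums_to_bounded c w l : sums_to c w l ->
  exists2 M : R, 0 < M & forall m, absv (fps_coef c m) * absv w ^+ m <= M.
Proof.
move=> /sums_to_term/cvg_absvP/cvgr0Pnorm_lt/(_ 1 ltr01)[K _ KP].
exists (\sum_(m < K) absv (fps_coef c m * w ^+ m) + 1).
  by rewrite ltr_wpDl // sumr_ge0 // => i _; apply: absv_ge0.
move=> m; rewrite -absvX -absvM; have [mK|Km] := ltnP m K.
  rewrite (bigD1 (Ordinal mK)) //= -addrA lerDl addr_ge0 //.
  by rewrite sumr_ge0 // => i _; apply: absv_ge0.
have := KP m Km; rewrite /= subr0 ger0_norm ?absv_ge0 // => /ltW cm.
by apply: le_trans cm _; rewrite lerDr sumr_ge0 // => i _; apply: absv_ge0.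
Qed.

Section Ultrametric.
Hypothesis um : ultrametric L.

Lemma ultrametric_sum I (r : seq I) (P : pred I) (F : I -> L) (e : R) :
  0 <= e -> (forall i, P i -> absv (F i) <= e) ->
  absv (\sum_(i <- r | P i) F i) <= e.
Proof.
move=> e0 Fe; apply: (big_ind (fun x => absv x <= e)) => //.
  by rewrite absv0.
by move=> x y xe ye; apply: le_trans (um x y) _; rewrite ge_max xe.
Qed.

(** In each term of the tail one index is large, so one factor is small and the other bounded; an
    ultrametric sum is no larger than its largest term. *)
Lemma ultrametric_cauchy_tail c d w l l' : sums_to c w l -> sums_to d w l' ->
  cauchy_tail c d w @ \oo --> (0 : L).
Proof.
move=> cl dl; have [A A0 cA] := sums_to_bounded cl.
have [B B0 dB] := sums_to_bounded dl.
apply/cvg_absvP/cvgr0Pnorm_lt => e e0.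
have eA0 : 0 < e / (2 * A) by rewrite divr_gt0 // mulr_gt0.
have eB0 : 0 < e / (2 * B) by rewrite divr_gt0 // mulr_gt0.
have /cvg_absvP/cvgr0Pnorm_lt/(_ _ eB0)[K _ KP] := sums_to_term cl.
have /cvg_absvP/cvgr0Pnorm_lt/(_ _ eA0)[K' _ KP'] := sums_to_term dl.
near=> N; rewrite subr0 ger0_norm ?absv_ge0 //.
apply: (@le_lt_trans _ _ (e / 2)); last by lra.
have e20 : 0 <= e / 2 by lra.
apply: ultrametric_sum => // i _; rewrite big_seq_cond.
apply: ultrametric_sum => // j; rewrite mem_index_iota andbT => /andP[Nij _].
rewrite absvM !(absvM (fps_coef _ _)) !absvX.
have NK : (K + K' <= N)%N by near: N; apply: nbhs_infty_ge.
(* As [i + j] is at least [N], hence at least [K + K'], either [i >= K] or [j >= K']. *)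
have [Ki|iK] := leqP K i.
  have /ltW := KP i Ki; rewrite /= subr0 ger0_norm ?absv_ge0 // absvM absvX => ci.
  have -> : e / 2 = e / (2 * B) * B by field; rewrite gt_eqF.
  by apply: ler_pM => //; rewrite mulr_ge0 ?exprn_ge0 ?absv_ge0.
have K'j : (K' <= j)%N by lia.
have /ltW := KP' j K'j; rewrite /= subr0 ger0_norm ?absv_ge0 // absvM absvX => dj.
have -> : e / 2 = A * (e / (2 * A)) by field; rewrite gt_eqF.
by apply: ler_pM => //; rewrite mulr_ge0 ?exprn_ge0 ?absv_ge0.
Unshelve. all: by end_near. Qed.

End Ultrametric.

(** * Bounds on coefficients and local expansions *)

Definition coef_bound (rho M : R) c :=
  forall m, absv (fps_coef c m) * rho ^+ m <= M.

Lemma coef_bound_term rho M c w t m : 0 < rho -> coef_bound rho M c ->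
  absv w <= rho * t -> absv (fps_coef c m * w ^+ m) <= M * t ^+ m.
Proof.
move=> rho0 cM wt; rewrite absvM absvX.
apply: le_trans (_ : absv (fps_coef c m) * (rho * t) ^+ m <= _).
  by rewrite ler_wpM2l ?absv_ge0 // lerXn2r ?nnegrE ?absv_ge0 // (le_trans _ wt) ?absv_ge0.
have t0 : 0 <= t by rewrite -(pmulr_rge0 _ rho0) (le_trans _ wt) ?absv_ge0.
by rewrite exprMn mulrA ler_wpM2r ?exprn_ge0.
Qed.

(* The tail has at most [N ^ 2 <= 4 ^ N] terms, each at most [A * B / 8 ^ N]. *)
Lemma geometric_cauchy_tail rho A B c d w : 0 < rho ->
  coef_bound rho A c -> coef_bound rho B d -> absv w <= rho * 8^-1 ->
  cauchy_tail c d w @ \oo --> (0 : L).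
Proof.
move=> rho0 cA dB w8; apply/cvg_absvP.
have A0 : 0 <= A by apply: le_trans (cA 0%N); rewrite mulr_ge0 ?absv_ge0.
have B0 : 0 <= B by apply: le_trans (dB 0%N); rewrite mulr_ge0 ?absv_ge0.
have H : (fun N : nat => A * B * 2^-1 ^+ N : R) @ \oo --> (A * B * 0 : R).
  apply: cvgM; first exact: cvg_cst.
  by apply: cvg_expr; rewrite ger0_norm; lra.
rewrite mulr0 in H; apply: squeeze_cvgr (@cvg_cst _ (0 : R) _ _ _) H.
near=> N; rewrite absv_ge0 /= subr0.
have tE (x : R) : x * N%:R = \sum_(i < N) x.
  by rewrite sumr_const card_ord mulr_natr.
apply: le_trans (_ : A * B * 8^-1 ^+ N * N%:R * N%:R <= _); last first.
  rewrite -!mulrA ler_wpM2l // ler_wpM2l // -natrM.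
  apply: le_trans (_ : 8^-1 ^+ N * (4 ^ N)%:R <= _).
    rewrite ler_wpM2l ?exprn_ge0 ?invr_ge0 // ler_nat -[4%N]/(2 * 2)%N expnMn.
    by apply: leq_mul; apply/ltnW/ltn_expl.
  rewrite natrX -exprMn lerXn2r ?nnegrE //; lra.
rewrite tE; apply: le_trans (absv_sum _ _ _) _; apply: ler_sum => i _.
apply: le_trans (absv_sum _ _ _) _; rewrite tE -(big_mkord xpredT (fun=> _)).
rewrite [leRHS](@big_cat_nat _ _ _ (N - i)) ?leq_subr //=.
apply: ler_wpDl.
  by rewrite sumr_ge0 // => j _; rewrite !mulr_ge0 ?exprn_ge0 ?invr_ge0.
rewrite big_seq_cond [leRHS]big_seq_cond; apply: ler_sum => j.
rewrite mem_index_iota andbT => /andP[Nij _]; rewrite absvM.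
apply: le_trans (_ : (A * 8^-1 ^+ i) * (B * 8^-1 ^+ j) <= _).
  by apply: ler_pM; rewrite ?absv_ge0 //; apply: coef_bound_term w8.
rewrite mulrACA -exprD ler_wpM2l ?mulr_ge0 //.
by apply: ler_wiXn2l; [lra|lra|lia].
Unshelve. all: by end_near. Qed.

Lemma coef_boundD rho A B c d :
  coef_bound rho A c -> coef_bound rho B d -> 0 <= rho ->
  coef_bound rho (A + B) (c + d).
Proof.
move=> cA dB rho0 m; apply: le_trans (_ : (absv (fps_coef c m) +
  absv (fps_coef d m)) * rho ^+ m <= _).
  by rewrite ler_wpM2r ?exprn_ge0 // absvD.
by rewrite mulrDl lerD.
Qed.

(** The coefficient of index [m] is a sum of [m + 1] products, each at most [A * B / rho ^+ m].
    Shrinking the radius by 8 absorbs the factor [m + 1] and matches the radius in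
    [geometric_cauchy_tail]. *)
Lemma coef_boundM rho A B c d : 0 < rho ->
  coef_bound rho A c -> coef_bound rho B d ->
  coef_bound (rho * 8^-1) (A * B) (c * d).
Proof.
move=> rho0 cA dB m.
have A0 : 0 <= A by apply: le_trans (cA 0%N); rewrite mulr_ge0 ?absv_ge0.
have B0 : 0 <= B by apply: le_trans (dB 0%N); rewrite mulr_ge0 ?absv_ge0.
apply: le_trans (_ : (\sum_(l < m.+1) A * B) * 8^-1 ^+ m <= _); last first.
  rewrite sumr_const card_ord -[_ *+ m.+1]mulr_natr -mulrA ler_piMr ?mulr_ge0 //.
  rewrite exprVn ler_pdivrMr ?exprn_gt0 // mul1r -natrX ler_nat.
  by apply: leq_trans (ltn_expl m (_ : 1 < 8)%N) _.
rewrite exprMn mulrA ler_wpM2r ?exprn_ge0 ?invr_ge0 //.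
apply: le_trans (_ : (\sum_(l < m.+1) absv (fps_coef c l * fps_coef d (m - l)))
    * rho ^+ m <= _).
  by rewrite ler_wpM2r ?exprn_ge0 ?(ltW rho0) // /= absv_sum.
rewrite mulr_suml; apply: ler_sum => l _.
have -> : rho ^+ m = rho ^+ l * rho ^+ (m - l) by rewrite -exprD subnKC // -ltnS.
by rewrite absvM mulrACA ler_pM ?mulr_ge0 ?exprn_ge0 ?absv_ge0 ?(ltW rho0).
Qed.

Lemma coef_bound_le rho rho' M c :
  0 <= rho' <= rho -> coef_bound rho M c -> coef_bound rho' M c.
Proof.
move=> /andP[r0 r1] cM m; apply: le_trans (cM m).
by rewrite ler_wpM2l ?absv_ge0 // lerXn2r ?nnegrE // (le_trans r0).
Qed.

(** The coefficient bound is kept with the expansion because it makes products converge, on a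
    smaller disc. *)
Definition represents a c (G : L -> L) := exists rho M : R,
  [/\ 0 < rho, coef_bound rho M c &
      forall w, absv w < rho -> sums_to c w (G (a + w))].

Lemma representsP a c d G H : represents a c G -> represents a d H ->
  exists rho A B : R, [/\ 0 < rho, coef_bound rho A c, coef_bound rho B d,
    forall w, absv w < rho -> sums_to c w (G (a + w)) &
    forall w, absv w < rho -> sums_to d w (H (a + w))].
Proof.
move=> [r [A [r0 cA cG]]] [s [B [s0 dB dH]]].
exists (Num.min r s), A, B; split.
- by rewrite lt_min r0.
- by apply: coef_bound_le cA; rewrite le_min (ltW r0) (ltW s0) ge_min lexx.
- by apply: coef_bound_le dB; rewrite le_min (ltW r0) (ltW s0) ge_min lexx orbT.
- by move=> w; rewrite lt_min => /andP[/cG].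
- by move=> w; rewrite lt_min => /andP[_ /dH].
Qed.

Lemma representsD a c d G H : represents a c G -> represents a d H ->
  represents a (c + d) (fun z => G z + H z).
Proof.
move=> cG /(representsP cG)[r [A [B [r0 cA dB {}cG dH]]]].
exists r, (A + B); split=> //; first exact: coef_boundD (ltW r0).
by move=> w wr; apply: sums_toD; [apply: cG|apply: dH].
Qed.

Lemma representsM a c d G H : represents a c G -> represents a d H ->
  represents a (c * d) (fun z => G z * H z).
Proof.
move=> cG /(representsP cG)[r [A [B [r0 cA dB {}cG dH]]]].
exists (r * 8^-1), (A * B); split=> [||w wr].
- by rewrite mulr_gt0 ?invr_gt0.
- exact: coef_boundM.
have wr' : absv w < r by apply: lt_le_trans wr _; rewrite ler_piMr ?(ltW r0) //; lra.
apply: sums_toM; [exact: cG|exact: dH|].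
exact: geometric_cauchy_tail (ltW wr).
Qed.

Lemma represents_poly a (p : {poly L}) :
  represents a (poly_fps (p \Po ('X + a%:P))) (fun z => p.[z]).
Proof.
set q := p \Po _; exists 1, (\sum_(i < size q) absv q`_i); split=> // [m|w _].
  rewrite expr1n mulr1 /=; have [mq|qm] := ltnP m (size q).
    by rewrite (bigD1 (Ordinal mq)) //= lerDl sumr_ge0 // => i _; apply: absv_ge0.
  by rewrite nth_default // absv0 sumr_ge0 // => i _; apply: absv_ge0.
have -> : p.[a + w] = q.[w] by rewrite horner_comp !hornerE addrC.
exact: sums_to_poly.
Qed.

Section Archimedean.
Hypothesis not_um : ~ ultrametric L.

(** Without an element of absolute value strictly between 0 and 1, inversion shows the absolute
    value to be trivial, hence ultrametric. Powers of such an element become as small as desired. *)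
Lemma small_elements (e : R) : 0 < e -> exists2 w : L, w != 0 & absv w < e.
Proof.
move=> e0; have [x x0 x1] : exists2 x : L, x != 0 & absv x < 1.
  apply: contrapT => no_x.
  have ge1 (x : L) : x != 0 -> 1 <= absv x.
    by move=> x0; rewrite leNgt; apply/negP => x1; apply: no_x; exists x.
  have abs1 (x : L) : x != 0 -> absv x = 1 :> R.
    move=> x0; apply: le_anti; rewrite ge1 // andbT -invf_ge1 ?lt_def ?absv_ge0 ?absv_eq0 ?x0 //.
    by rewrite -absvV ge1 // invr_eq0.
  apply: not_um => x y; have [xy0|xy0] := eqVneq (x + y) 0.
    by rewrite xy0 absv0 le_max absv_ge0.
  rewrite (abs1 _ xy0) le_max; have [x0|x0] := eqVneq x 0.
    by rewrite (abs1 y) ?lexx ?orbT //; apply: contraNneq xy0 => ->; rewrite x0 addr0.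
  by rewrite (abs1 x x0) lexx.
have H : (fun n : nat => absv x ^+ n : R) @ \oo --> (0 : R).
  by apply: cvg_expr; rewrite ger0_norm ?absv_ge0.
have /cvgr0Pnorm_lt/(_ e e0)[N _ /(_ N (leqnn N))] := H.
rewrite /= ger0_norm ?exprn_ge0 ?absv_ge0 // -absvX => xN.
by exists (x ^+ N); rewrite ?expf_neq0.
Qed.

(** Convergence at one nonzero point [w] bounds the coefficients at radius [absv w]; such a point
    exists near 0 because [L] is not ultrametric. *)
Lemma expansion_represents (U : set L) G a (c : nat -> L) :
  expansion_at U G a c -> represents a (Fps c) G.
Proof.
move=> [V [[V_open Va] _ _ _ VG]].
have /nbhs_absvP[e e0 eV] : nbhs a V by apply: open_nbhs_nbhs.
have VG' w : absv w < e -> sums_to (Fps c) w (G (a + w)).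
  move=> we; have := VG (a + w); rewrite addrAC subrr add0r seriesE; apply.
  by apply: eV; rewrite addrAC subrr add0r.
have [w w0 we] := small_elements e0.
have [M _ wM] := sums_to_bounded (VG' w we).
exists (absv w), M; split=> // [|v vw]; first by rewrite lt_def absv_ge0 absv_eq0 w0.
by apply: VG'; apply: lt_trans vw we.
Qed.

End Archimedean.

(** * Isolated zeros and the identity theorem *)

Lemma psums_near0 rho M c w N : 0 < rho -> coef_bound rho M c ->
  absv w <= rho * 2^-1 ->
  absv (psums c w N.+1 - fps_coef c 0) <= 2 * M * (absv w / rho).
Proof.
move=> rho0 cM w2; set t := absv w / rho.
have M0 : 0 <= M by apply: le_trans (cM 0%N); rewrite mulr_ge0 ?absv_ge0.
have t0 : 0 <= t by rewrite divr_ge0 ?absv_ge0 ?(ltW rho0).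
have t2 : t <= 2^-1 by rewrite ler_pdivrMr // mulrC.
have wE : absv w <= rho * t by rewrite mulrC divfK ?gt_eqF.
rewrite /psums big_ord_recl expr0 mulr1 addrAC subrr add0r.
apply: le_trans (absv_sum _ _ _) _.
apply: le_trans (_ : \sum_(m < N) M * t * 2^-1 ^+ m <= _).
  apply: ler_sum => m _; apply: le_trans (coef_bound_term _ rho0 cM wE) _.
  rewrite [t ^+ _]exprS mulrA; apply: ler_wpM2l; first exact: mulr_ge0.
  by apply: lerXn2r => //; rewrite nnegrE invr_ge0.
rewrite -mulr_sumr [leRHS](_ : _ = M * t * 2); last by ring.
apply: ler_wpM2l; first exact: mulr_ge0.
suff -> : \sum_(i < N) 2^-1 ^+ i = 2 - 2 * 2^-1 ^+ N :> R.
  by rewrite lerBlDr lerDl mulr_ge0 ?exprn_ge0 ?invr_ge0.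
elim: N => [|K IHK]; first by rewrite big_ord0 expr0; ring.
by rewrite big_ord_recr /= IHK exprS; field.
Qed.

(** If [d] is the least index of a nonzero coefficient, then near 0 the series is [w ^+ d] times a
    factor close to this coefficient, so it has no small nonzero root. *)
Lemma accumulating_zeros a c G : represents a c G ->
  (forall e : R, 0 < e -> exists w, [/\ w != 0, absv w < e & G (a + w) = 0]) ->
  c = 0.
Proof.
move=> [rho [M [rho0 cM cG]]] zeros; apply: contrapT => c_neq0.
have exd : exists m, fps_coef c m != 0.
  apply: contrapT => nod; apply: c_neq0; apply: fps_ext => k; rewrite /= coef0.
  by apply/eqP/negPn/negP => ck; apply: nod; exists k.
case: (ex_minnP exd) => d cd m_min.
pose c' := Fps (fun k => fps_coef c (d + k)).
pose M' := M / rho ^+ d + 1.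
have c'M : coef_bound rho M' c'.
  move=> m; apply: le_trans (_ : M / rho ^+ d <= _); last by rewrite lerDl.
  rewrite ler_pdivlMr ?exprn_gt0 // -mulrA -exprD addnC; exact: cM.
have M'0 : 0 < M'.
  rewrite ltr_wpDl // divr_ge0 ?exprn_ge0 ?(ltW rho0) //.
  by apply: le_trans (cM 0%N); rewrite mulr_ge0 ?absv_ge0.
have cd0 : 0 < absv (fps_coef c d) :> R by rewrite lt_def absv_eq0 cd absv_ge0.
(* The second bound makes the error in [psums_near0] at most half the absolute value of the leading
   coefficient. *)
pose e := Num.min (rho * 2^-1) (absv (fps_coef c d) * rho / (4 * M')).
have e0 : 0 < e by rewrite lt_min mulr_gt0 ?invr_gt0 //= divr_gt0 ?mulr_gt0.
have [w [w0 we Gw]] := zeros e e0.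
have aw0 : 0 < absv w :> R by rewrite lt_def absv_eq0 w0 absv_ge0.
move: we; rewrite lt_min => /andP[we2 weM].
have wrho : absv w < rho by apply: lt_le_trans we2 _; rewrite ler_piMr ?(ltW rho0) //; lra.
have := cG w wrho; rewrite Gw => /cvg_absvP/cvgr0Pnorm_lt.
(* At a zero the partial sums eventually fall below half the size of the leading term, whereas
   [psums_near0] keeps them at least that large. *)
have h0 : 0 < absv w ^+ d * (absv (fps_coef c d) / 2) by rewrite mulr_gt0 ?exprn_gt0 // divr_gt0.
move=> /(_ _ h0)[K _ KP]; have dK : (K <= d + K.+1)%N by lia.
have := KP _ dK; rewrite /= subr0 ger0_norm ?absv_ge0 //.
have -> : psums c w (d + K.+1) = w ^+ d * psums c' w K.+1.
  rewrite /psums big_split_ord /= big1 ?add0r => [|i _]; last first.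
    apply/eqP; rewrite mulf_eq0; apply/orP; left; apply/negPn/negP => ci.
    by have := m_min _ ci; rewrite leqNgt ltn_ord.
  by rewrite mulr_sumr; apply: eq_bigr => i _; rewrite exprD mulrCA.
rewrite absvM absvX ltr_pM2l ?exprn_gt0 // => small.
have := psums_near0 K rho0 c'M (ltW we2); rewrite /= addn0 => near.
have : 2 * M' * (absv w / rho) <= absv (fps_coef c d) / 2.
  rewrite ltr_pdivlMr ?mulr_gt0 // in weM.
  rewrite mulrA ler_pdivrMr //; move: weM {near small}; set W := absv w.
  by set C := absv _; nra.
have : absv (fps_coef c d) <= absv (psums c' w K.+1) +
    absv (psums c' w K.+1 - fps_coef c d).
  rewrite absv_distC; apply: le_trans (absvD _ _).
  by rewrite addrC subrK.
lra.
Qed.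

(** The set [Z] of points near which [G] vanishes is open; it is closed in [U] because at a limit
    point the zeros accumulate and kill the expansion. *)
Lemma identity_theorem (U : set L) G : open U -> connected U ->
  (forall a, U a -> exists c, represents a c G) ->
  U 0 -> represents 0 0 G -> forall z, U z -> G z = 0.
Proof.
move=> U_open U_conn Grep U0 G0 z Uz.
pose Z := [set a | exists2 e : R, 0 < e & forall w, absv w < e -> G (a + w) = 0].
have rep0 a : represents a 0 G -> Z a.
  move=> [rho [M [rho0 _ cG]]]; exists rho => // w wr.
  apply: absv_cvg_unique (cG w wr) _.
  by have := @sums_to_poly 0 w; rewrite horner0 rmorph0.
suff UZ : U `&` Z = U.
  have [_ [e e0 /(_ 0)]] : (U `&` Z) z by rewrite UZ.
  by rewrite absv0 addr0; apply.
apply: U_conn; first by exists 0; split=> //; apply: rep0.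
- exists Z => //; rewrite openE => a [e e0 eG]; apply/nbhs_absvP; exists (e / 2).
    by rewrite divr_gt0.
  move=> y ya; exists (e / 2); first by rewrite divr_gt0.
  move=> w we; rewrite (_ : y + w = a + (y - a + w)); last by ring.
  by apply: eG; apply: le_lt_trans (absvD _ _) _; lra.
exists (closure Z); first exact: closed_closure.
apply/seteqP; split=> a [Ua Za]; split=> //; first exact: subset_closure.
have [c cG] := Grep a Ua; apply: contrapT => nZa.
apply: (nZa); apply: rep0; rewrite -(accumulating_zeros cG) // => e e0.
have [b [Zb /= ba]] : Z `&` [set y | absv (y - a) < e] !=set0.
  by apply: Za; apply/nbhs_absvP; exists e.
exists (b - a); split=> //.
  by apply: contra_notN nZa; rewrite subr_eq0 => /eqP <-.
by have [h h0 /(_ 0)] := Zb; rewrite absv0 addr0 [a + _]addrC subrK; apply.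
Qed.

End AbsoluteValue.

(** * Specialization of relations *)

Section MultivariateEvaluation.

(** Serves both for summation at a point and for local representation, once these are known to pass
    through sums and products. The parameter [t] lets [Rel] concern whole functions. *)
Lemma mmap_rel (A B C : comNzRingType) (T : Type) n
    (Rel : B -> (T -> C) -> Prop) (phi : A -> B) (psi : T -> A -> C)
    (u : 'I_n -> B) (v : T -> 'I_n -> C) (Q : mpoly.mpoly n A) :
  Rel 0 (fun=> 0) -> Rel 1 (fun=> 1) ->
  (forall b c G H, Rel b G -> Rel c H -> Rel (b + c) (fun t => G t + H t)) ->
  (forall b c G H, Rel b G -> Rel c H -> Rel (b * c) (fun t => G t * H t)) ->
  (forall a, Rel (phi a) (psi^~ a)) -> (forall i, Rel (u i) (v^~ i)) ->
  Rel (mpoly.mmap phi u Q) (fun t => mpoly.mmap (psi t) (v t) Q).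
Proof.
move=> Rel0 Rel1 RelD RelM Rel_phi Rel_u.
have Rel_eq b G H : Rel b G -> G =1 H -> Rel b H by move=> bG /funext <-.
have Rel_sum I (r : seq I) b (G : I -> T -> C) : (forall i, Rel (b i) (G i)) ->
    Rel (\sum_(i <- r) b i) (fun t => \sum_(i <- r) G i t).
  move=> bG; elim: r => [|i r IHr].
    by rewrite big_nil; apply: Rel_eq Rel0 _ => t; rewrite big_nil.
  rewrite big_cons; apply: Rel_eq (RelD _ _ _ _ (bG i) IHr) _ => t.
  by rewrite big_cons.
have Rel_prod I (r : seq I) b (G : I -> T -> C) : (forall i, Rel (b i) (G i)) ->
    Rel (\prod_(i <- r) b i) (fun t => \prod_(i <- r) G i t).
  move=> bG; elim: r => [|i r IHr].
    by rewrite big_nil; apply: Rel_eq Rel1 _ => t; rewrite big_nil.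
  rewrite big_cons; apply: Rel_eq (RelM _ _ _ _ (bG i) IHr) _ => t.
  by rewrite big_cons.
apply: Rel_sum => m; apply: (RelM) => //; apply: Rel_prod => i.
elim: (m i) => [|k IHk]; first exact: Rel1.
rewrite exprS; apply: Rel_eq (RelM _ _ _ _ (Rel_u i) IHk) _ => t.
by rewrite exprS.
Qed.

Lemma rmorph_mmap (A : nzRingType) (B C : comNzRingType) n
    (g : {rmorphism B -> C}) (phi : A -> B) (u : 'I_n -> B)
    (Q : mpoly.mpoly n A) :
  g (mpoly.mmap phi u Q) = mpoly.mmap (g \o phi) (g \o u) Q.
Proof.
rewrite /mpoly.mmap rmorph_sum; apply: eq_bigr => m _ /=.
rewrite rmorphM /mpoly.mmap1 rmorph_prod; congr (_ * _).
by apply: eq_bigr => i _; rewrite rmorphXn.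
Qed.

Lemma mmap_map_mpoly (A B : nzRingType) (C : comNzRingType) n (g : A -> B)
    (h : {rmorphism B -> C}) (v : 'I_n -> C) (Q : mpoly.mpoly n A) :
  mpoly.mmap h v (mpoly.map_mpoly g Q) = mpoly.mmap (h \o g) v Q.
Proof.
rewrite /mpoly.map_mpoly {2 3}/mpoly.mmap rmorph_sum; apply: eq_bigr => m _ /=.
rewrite rmorphM /= mpoly.mmapC /mpoly.mmap1 rmorph_prod; congr (_ * _).
apply: eq_bigr => i _; rewrite (rmorphXn (mpoly.mmap h v)) /=.
by rewrite mpoly.mmapX mpoly.mmap1U.
Qed.

End MultivariateEvaluation.

Section MapPowerSeries.
Variables (F G : fieldType) (j : {rmorphism F -> G}).

Definition fps_map (c : fps F) : fps G := Fps (j \o fps_coef c).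

Fact fps_map_is_zmod_morphism : zmod_morphism fps_map.
Proof. by move=> c d; apply: fps_ext => k; rewrite /= rmorphB. Qed.
Fact fps_map_is_monoid_morphism : monoid_morphism fps_map.
Proof.
split=> [|c d]; apply: fps_ext => k /=; first by rewrite !coef1 rmorph_nat.
by rewrite rmorph_sum; apply: eq_bigr => l _; rewrite rmorphM.
Qed.
HB.instance Definition _ :=
  GRing.isZmodMorphism.Build (fps F) (fps G) fps_map fps_map_is_zmod_morphism.
HB.instance Definition _ :=
  GRing.isMonoidMorphism.Build (fps F) (fps G) fps_map fps_map_is_monoid_morphism.

Lemma fps_map_poly (p : {poly F}) :
  fps_map (poly_fps p) = poly_fps (map_poly j p).
Proof. by apply: fps_ext => k; rewrite /= coef_map. Qed.

Lemma fps_map_mmap n (u : 'I_n -> fps F) (Q : mpoly.mpoly n {poly F}) :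
  fps_map (mpoly.mmap poly_fps u Q) =
  mpoly.mmap (poly_fps \o map_poly j) (fps_map \o u) Q.
Proof.
rewrite rmorph_mmap; congr (mpoly.mmap _ _ Q); apply/funext => p.
exact: fps_map_poly.
Qed.

End MapPowerSeries.

Lemma cons1_comp (A B : nzRingType) n (g : A -> B) (v : 'I_n -> A) :
  g 1 = 1 -> g \o cons1 v = cons1 (g \o v).
Proof.
by move=> g1; apply/funext => k; rewrite /cons1 /=; case: unlift.
Qed.

(** Over an ultrametric field the expansions at 0 converge on all of [U], hence at [alpha] itself.
    Otherwise the identity theorem shows that the function obtained from [Q] vanishes on [U]. *)
Lemma relation_specializes (R : realType) (F : fieldType)
    (L : valuedFieldType R) (j : {rmorphism F -> L}) n (f : 'I_n -> fps F)
    (U : set L) (fU : 'I_n -> L -> L) (alpha : F)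
    (Q : mpoly.mpoly n.+1 {poly F}) :
  domain U -> U 0 -> (forall k, analytic_on U (fU k)) ->
  (forall k, expansion_at U (fU k) 0 (j \o fps_coef (f k))) -> U (j alpha) ->
  mpoly.mmap poly_fps (cons1 f) Q = 0 ->
  mpoly.mmap j (cons1 (fun k => fU k (j alpha))) (ev alpha Q) = 0.
Proof.
move=> [U_open U_conn _] U0 fU_an fU0 Ua fQ; rewrite mmap_map_mpoly.
have evE : j \o horner_eval alpha = fun p => (map_poly j p).[j alpha].
  by apply/funext => p; rewrite horner_map.
rewrite evE; have [um|not_um] := pselect (ultrametric L).
  pose Rel (c : fps L) (G : unit -> L) := sums_to c (j alpha) (G tt).
  have : Rel (mpoly.mmap (poly_fps \o map_poly j) (fps_map j \o cons1 f) Q)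
      (fun=> mpoly.mmap (fun p => (map_poly j p).[j alpha])
        (cons1 (fun k => fU k (j alpha))) Q).
    have poly_rel p : Rel (poly_fps p) (fun=> p.[j alpha]) := @sums_to_poly _ _ p _.
    apply: mmap_rel.
    - by have := poly_rel 0; rewrite horner0 rmorph0.
    - by have := poly_rel 1; rewrite hornerC rmorph1.
    - by move=> c d G H; apply: sums_toD.
    - move=> c d G H cG dH; apply: sums_toM => //.
      exact: (ultrametric_cauchy_tail um cG dH).
    - by move=> p; apply: poly_rel.
    - rewrite cons1_comp ?rmorph1 // => i; rewrite /cons1; case: unlift => [k|] /=.
        have [V [_ _ _ /(_ um) -> VG]] := fU0 k.
        have := VG _ Ua; rewrite (_ : (fun m => _) =
          fun m => (j \o fps_coef (f k)) m * j alpha ^+ m) ?seriesE //.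
        by apply/funext => m; rewrite subr0.
      by have := poly_rel 1; rewrite hornerC rmorph1.
  rewrite -fps_map_mmap fQ rmorph0 /Rel => sum0.
  apply: absv_cvg_unique sum0 _.
  by have := @sums_to_poly _ _ (0 : {poly L}) (j alpha); rewrite horner0 rmorph0.
pose G z := mpoly.mmap (fun p => (map_poly j p).[z]) (cons1 (fun k => fU k z)) Q.
have repG a (c : 'I_n -> fps L) : (forall k, represents a (c k) (fU k)) ->
    represents a (mpoly.mmap (fun p => poly_fps (map_poly j p \Po ('X + a%:P)))
      (cons1 c) Q) G.
  move=> cf; have poly_rel := @represents_poly _ _ a.
  apply: mmap_rel.
  - have := poly_rel 0; rewrite comp_poly0 rmorph0.
    by rewrite (_ : (fun z => _) = fun=> 0) //; apply/funext => z; rewrite horner0.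
  - have := poly_rel 1; rewrite comp_polyC rmorph1.
    by rewrite (_ : (fun z => _) = fun=> 1) //; apply/funext => z; rewrite hornerC.
  - by move=> *; apply: representsD.
  - by move=> *; apply: representsM.
  - by move=> p; apply: poly_rel.
  - move=> i; rewrite /cons1; case: unlift => [k|] //=.
    have := poly_rel 1; rewrite comp_polyC rmorph1.
    by rewrite (_ : (fun z => _) = fun=> 1) //; apply/funext => z; rewrite hornerC.
suff GU z : U z -> G z = 0 by exact: GU Ua.
move: z; apply: (identity_theorem U_open (U_conn not_um)) => //.
  move=> a Ua'; have := fun k => fU_an k a Ua'.
  move=> /choice[c cE]; eexists; apply: (repG a (fun k => Fps (c k))) => k.
  exact: (expansion_represents not_um (cE k)).
(* At the origin the representing series is the image of [Q(z, 1, f)], which is zero. *)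
have := repG 0 (fun k => fps_map j (f k)).
rewrite -[cons1 _](@cons1_comp _ _ _ (fps_map j)) ?rmorph1 //.
rewrite (_ : (fun p => _) = poly_fps \o map_poly j); last first.
  by apply/funext => p; rewrite /= addr0 comp_polyXr.
rewrite -fps_map_mmap fQ rmorph0; apply=> k.
exact: (expansion_represents not_um (fU0 k)).
Qed.

(** * Rational functions and descent *)

Local Notation "x %:F" := (FracField.tofrac x).

Section RationalFunctions.
Variable F : fieldType.

Lemma fraction_exists (A : idomainType) (x : {fraction A}) :
  exists a b : A, b != 0 /\ x = a%:F / b%:F.
Proof.
exists (frac (repr x)).1, (frac (repr x)).2.
have d0 : (frac (repr x)).2 != 0 by exact: denom_ratioP.
by split=> //; rewrite -fraction_numden mulfK ?tofrac_eq0.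
Qed.

Fact ratfun_fps_is_zmod_morphism : zmod_morphism (@ratfun_fps F).
Proof.
move=> x y; have [a [b [b0 ->]]] := fraction_exists x.
have [c [d [d0 ->]]] := fraction_exists y.
rewrite !ratfun_fpsE // -!mulNr !addf_div ?tofrac_eq0 ?poly_fps_eq0 //.
rewrite -!rmorphN -!rmorphM -!rmorphD ratfun_fpsE ?mulf_neq0 //.
Qed.

Fact ratfun_fps_is_monoid_morphism : monoid_morphism (@ratfun_fps F).
Proof.
split=> [|x y].
  have -> : 1 = 1%:F / 1%:F :> {fraction {poly F}} by rewrite rmorph1 divr1.
  by rewrite ratfun_fpsE ?oner_neq0 // !rmorph1 divr1.
have [a [b [b0 ->]]] := fraction_exists x.
have [c [d [d0 ->]]] := fraction_exists y.
rewrite mulf_div -!rmorphM !ratfun_fpsE ?mulf_neq0 //.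
by rewrite mulf_div -!rmorphM.
Qed.

HB.instance Definition _ := GRing.isZmodMorphism.Build
  {fraction {poly F}} {fraction fps F} ratfun_fps ratfun_fps_is_zmod_morphism.
HB.instance Definition _ := GRing.isMonoidMorphism.Build
  {fraction {poly F}} {fraction fps F} ratfun_fps ratfun_fps_is_monoid_morphism.

Lemma ratfun_fps_tofrac (a : {poly F}) : ratfun_fps a%:F = (poly_fps a)%:F.
Proof.
have := @ratfun_fpsE _ a 1 (oner_neq0 _).
by rewrite !rmorph1 !divr1.
Qed.

Lemma ratfun_subfield : is_subfield (range (@ratfun_fps F)).
Proof.
apply/is_subfieldP; split; first by exists 1; rewrite ?rmorph1.
- by move=> _ _ [a _ <-] [b _ <-]; exists (a - b); rewrite ?rmorphB.
- by move=> _ _ [a _ <-] [b _ <-]; exists (a / b); rewrite ?fmorph_div.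
Qed.

Lemma clear_denominators (A : idomainType) (p : {poly {fraction A}}) :
  exists2 d, d != 0 & exists q, d%:F *: p = map_poly (@FracField.tofrac A) q.
Proof.
elim/poly_ind: p => [|p c [d d0 [q pq]]].
  by exists 1; rewrite ?oner_neq0 //; exists 0; rewrite scaler0 rmorph0.
have [a [b [b0 ->]]] := fraction_exists c.
exists (b * d); first exact: mulf_neq0.
exists (b *: q * 'X + (d * a)%:P).
rewrite [RHS]rmorphD [X in _ = X + _]rmorphM /= map_polyX map_polyZ map_polyC /= -pq.
rewrite scalerDr scalerA -rmorphM -scalerAl; congr (_ + _).
rewrite -mul_polyC -rmorphM; congr (_%:P).
rewrite [X in X * _]rmorphM [RHS]rmorphM /=; field; by rewrite tofrac_eq0.
Qed.

End RationalFunctions.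

(** * Descent on minors of coordinate vectors *)

Section Descent.
Variables (F : fieldType) (T : finType) (e : T -> fps F).

Definition fps_span (a : fps F) : Prop :=
  exists c : T -> {poly F}, a = \sum_i poly_fps (c i) * e i.

Definition free_on (I : {set T}) : Prop := forall c : T -> {poly F},
  \sum_(i in I) poly_fps (c i) * e i = 0 -> forall i, i \in I -> c i = 0.

(** Plays the role of a basis: a common denominator [D] carries the whole span into the free module
    on a maximal free subfamily [I]. *)
Lemma maximal_free_set : exists I (D : {poly F}), [/\ free_on I, D != 0 &
  forall a, fps_span a -> exists c : T -> {poly F},
    poly_fps D * a = \sum_(i in I) poly_fps (c i) * e i].
Proof.
have free0 : `[< free_on finset.set0 >].
  by apply/asboolP => c _ i; rewrite finset.inE.
have [I /maxsetP[/asboolP freeI maxI] _] :=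
  @maxset_exists _ (fun I => `[< free_on I >]) _ free0.
have dep j : exists D : {poly F}, D != 0 /\ exists c : T -> {poly F},
    poly_fps D * e j = \sum_(i in I) poly_fps (c i) * e i.
  have [jI|jI] := boolP (j \in I).
    exists 1; split; first exact: oner_neq0.
    exists (fun i => (i == j)%:R); rewrite (bigD1 j) //= eqxx rmorph1.
    by rewrite big1 ?addr0 // => i /andP[_ /negPf ->]; rewrite rmorph0 mul0r.
  (* By maximality, adding [j] creates a relation; the coefficient of [e j] in it is nonzero because
     [I] is free. *)
  have [c cI [i iI ci]] : exists2 c : T -> {poly F},
      \sum_(i in j |: I) poly_fps (c i) * e i = 0 &
      exists2 i, i \in j |: I & c i != 0.
    apply: contrapT => no_c; move: jI; rewrite -(maxI (j |: I)) ?finset.setU11 //.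
      apply/asboolP => c cI i iI; apply/eqP/negPn/negP => ci.
      by apply: no_c; exists c => //; exists i.
    exact: finset.subsetUr.
  rewrite big_setU1 //= in cI; exists (c j); split.
    apply: contraNneq ci => cj; move: cI; rewrite cj rmorph0 mul0r add0r => cI.
    by move: iI; rewrite !finset.inE => /orP[/eqP ->|/(freeI _ cI) ->] //; apply/eqP.
  exists (fun i => - c i); move/eqP: cI; rewrite addr_eq0 => /eqP ->.
  by rewrite -sumrN; apply: eq_bigr => i' _; rewrite rmorphN mulNr.
have [D DE] := choice dep; exists I, (\prod_j D j); split=> //.
  by apply/prodf_neq0 => j _; have [] := DE j.
move=> _ [a ->]; have [c cE] := choice (fun j => (DE j).2).
exists (fun i => \sum_j a j * (\prod_(l | l != j) D l) * c j i).
under [RHS]eq_bigr => i _ do rewrite rmorph_sum mulr_suml.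
rewrite exchange_big mulr_sumr; apply: eq_bigr => j _ /=.
rewrite (bigD1 j) //= rmorphM mulrACA -[_ * e j]mulrC; rewrite [X in X = _](_ : _ =
  poly_fps (a j * \prod_(l | l != j) D l) * (poly_fps (D j) * e j)).
  rewrite cE mulr_sumr; apply: eq_bigr => i _.
  by rewrite mulrA -!rmorphM.
by rewrite rmorphM; ring.
Qed.

(* The coordinate vectors of [a] and [b] have a nonzero 2x2 minor, and each
   step divides that minor by ['X - alpha]. *)
Lemma no_infinite_descent (alpha : F) (good : fps F -> fps F -> Prop) :
  (forall a b, good a b -> [/\ fps_span a, fps_span b &
     forall u v, poly_fps u * a + poly_fps v * b = 0 -> u = 0 /\ v = 0]) ->
  (forall a b, good a b -> exists c,
     (b = poly_fps ('X - alpha%:P) * c /\ good a c) \/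
     (exists gamma, a - poly_fps gamma * b = poly_fps ('X - alpha%:P) * c
        /\ good c b)) ->
  forall a b, ~ good a b.
Proof.
move=> goodP step; have [I [D [freeI D0 coord]]] := maximal_free_set.
pose X := 'X - alpha%:P; have X0 : X != 0 by rewrite polyXsubC_eq0.
pose coord_of a c := poly_fps D * a = \sum_(i in I) poly_fps (c i) * e i.
have coord0 c : \sum_(i in I) poly_fps (c i) * e i = 0 ->
  forall i, i \in I -> c i = 0 by apply: freeI.
(* Induction on the size of a nonzero minor, with the same two columns all along. *)
suff no_minor N a b ca cb i l : good a b -> coord_of a ca -> coord_of b cb ->
    i \in I -> l \in I -> ca i * cb l - ca l * cb i != 0 ->
    (size (ca i * cb l - ca l * cb i)%R <= N)%N -> False.
  move=> a b ab; have [/coord[ca caE] /coord[cb cbE] ab_free] := goodP a b ab.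
  have D_neq0 : poly_fps D != 0 by rewrite poly_fps_eq0.
  have [i iI ca_i] : exists2 i, i \in I & ca i != 0.
    apply: contrapT => noi; case/eqP: D0; have [] // := ab_free D 0.
    rewrite rmorph0 mul0r addr0 caE big1 // => i iI.
    have [->|ci] := eqVneq (ca i) 0; first by rewrite rmorph0 mul0r.
    by case: noi; exists i.
  (* Otherwise [cb i * a = ca i * b], against independence. *)
  have [l lI minor] : exists2 l, l \in I & ca i * cb l - ca l * cb i != 0.
    apply: contrapT => nol; case/eqP: ca_i.
    have [_ /eqP] : cb i = 0 /\ - ca i = 0; last by rewrite oppr_eq0 => /eqP.
    apply: ab_free; apply: (mulfI D_neq0); rewrite mulr0 mulrDr !(mulrCA (poly_fps D)).
    rewrite caE cbE !mulr_sumr -big_split big1 // => l lI /=.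
    rewrite !mulrA -mulrDl -!rmorphM -rmorphD.
    have -> : cb i * ca l + - ca i * cb l = - (ca i * cb l - ca l * cb i) by ring.
    have [->|cl] := eqVneq (ca i * cb l - ca l * cb i) 0.
      by rewrite oppr0 rmorph0 mul0r.
    by case: nol; exists l.
  exact: (no_minor _ _ _ _ _ _ _ ab caE cbE iI lI minor (leqnn _)).
elim: N a b ca cb i l => [|N IHN] a b ca cb i l ab caE cbE iI lI minor.
  by rewrite leqn0 size_poly_eq0 (negPf minor).
move=> sizeN; have lower (m : {poly F}) : ca i * cb l - ca l * cb i = X * m ->
    m != 0 /\ (size m <= N)%N.
  move=> mE; have m0 : m != 0.
    by apply: contraNneq minor => m0; rewrite mE m0 mulr0.
  split=> //; move: sizeN; rewrite mE size_mul // size_XsubC addSn add1n /=.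
  by rewrite ltnS.
have [c [[bE ac]|[gamma [aE cb']]]] := step a b ab.
  have [_ /coord[cc ccE] _] := goodP a c ac.
  (* Coordinates on a free family are unique, so dividing [b] by [X] divides each of them. *)
  have ccI i' : i' \in I -> cb i' = X * cc i'.
    move=> i'I; apply/eqP; rewrite -subr_eq0; apply/eqP.
    apply: (coord0 (fun i => cb i - X * cc i)) i'I.
    rewrite [RHS](_ : 0 = poly_fps D * b - poly_fps X * (poly_fps D * c)); last first.
      by rewrite bE mulrCA subrr.
    rewrite cbE ccE mulr_sumr -sumrB; apply: eq_bigr => i'' _.
    by rewrite rmorphB rmorphM; ring.
  have mE : ca i * cb l - ca l * cb i = X * (ca i * cc l - ca l * cc i).
    by rewrite !ccI //; ring.
  have [m0 mN] := lower _ mE.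
  by apply: (IHN _ _ _ _ _ _ ac caE ccE iI lI m0 mN).
have [/coord[cc ccE] _ _] := goodP c b cb'.
have ccI i' : i' \in I -> ca i' = X * cc i' + gamma * cb i'.
  move=> i'I; apply/eqP; rewrite -subr_eq0; apply/eqP.
  apply: (coord0 (fun i => ca i - (X * cc i + gamma * cb i))) i'I.
  rewrite [RHS](_ : 0 = poly_fps D * a - (poly_fps X * (poly_fps D * c) +
      poly_fps gamma * (poly_fps D * b))); last first.
    by rewrite -[a](subrK (poly_fps gamma * b)) aE -/X; ring.
  rewrite caE ccE cbE !mulr_sumr -big_split -sumrB; apply: eq_bigr => i'' _ /=.
  by rewrite rmorphB rmorphD !rmorphM; ring.
(* Subtracting [gamma * b] from [a] leaves the minor unchanged. *)
have mE : ca i * cb l - ca l * cb i = X * (cc i * cb l - cc l * cb i).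
  by rewrite !ccI //; ring.
have [m0 mN] := lower _ mE.
by apply: (IHN _ _ _ _ _ _ cb' ccE cbE iI lI m0 mN).
Qed.

End Descent.

(** * Roots over a closed field and specialization at [alpha] *)

Section ClosedFieldRoots.
Variable F : fieldType.
Hypothesis F_closed : GRing.closed_field_axiom F.

Lemma closed_root_exists (p : {poly F}) : (1 < size p)%N -> exists x, root p x.
Proof.
move=> p_gt1; set d := (size p).-1.
have d0 : (0 < d)%N by rewrite /d; case: (size p) p_gt1 => [|[]].
have p0 : lead_coef p != 0 by rewrite lead_coef_eq0 -size_poly_gt0 ltnW.
(* The axiom solves monic equations, hence the division by the leading coefficient. *)
have [x xE] := F_closed (fun i => - (p`_i / lead_coef p)) d0.
exists x; rewrite rootE horner_coef -[size p]prednK ?(ltnW p_gt1) // -/d.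
rewrite big_ord_recr /= xE -lead_coefE mulr_sumr -big_split big1 // => i _ /=.
by field.
Qed.

Lemma closed_root_descends (G : fieldType) (j : {rmorphism F -> G})
    (p : {poly F}) x : p != 0 -> root (map_poly j p) x -> exists y, x = j y.
Proof.
have [N] := ubnP (size p); elim: N p => // N IHN p pN p0 px.
have p_gt1 : (1 < size p)%N.
  by rewrite -(size_map_poly j) (root_size_gt1 _ px) // map_poly_eq0.
have [y /factor_theorem[q pE]] := closed_root_exists p_gt1.
have q0 : q != 0 by apply: contraNneq p0 => q0; rewrite pE q0 mul0r.
move: px; rewrite pE rmorphM rootM /= map_polyXsubC root_XsubC.
case/orP=> [qx|/eqP ->]; last by exists y.
by apply: IHN qx => //; move: pN; rewrite pE size_Mmonic ?monicXsubC // size_XsubC addn2.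
Qed.

End ClosedFieldRoots.

Section SpecializedPolynomials.
Variables (F : fieldType) (alpha : F).

Local Notation X := ('X - alpha%:P).

Lemma horner_eval_eq0 (a : {poly F}) : a.[alpha] = 0 -> a = X * (a %/ X).
Proof. by move=> a0; rewrite mulrC divpK // dvdp_XsubCl rootE a0. Qed.

(** As long as [q] vanishes at [alpha], a factor [X] is taken out of all coefficients; the degree of
    the leading one drops each time. *)
Lemma primitive_part (q : {poly {poly F}}) : q != 0 ->
  exists k (q' : {poly {poly F}}), q = X ^+ k *: q' /\
    map_poly (horner_eval alpha) q' != 0.
Proof.
have [N] := ubnP (size (lead_coef q)); elim: N q => // N IHN q qN q0.
have [q0'|q0'] := eqVneq (map_poly (horner_eval alpha) q) 0; last first.
  by exists 0%N, q; rewrite expr0 scale1r.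
pose q1 := \poly_(i < size q) (q`_i %/ X).
have qE : q = X *: q1.
  apply/polyP => i; rewrite coefZ coef_poly; case: ltnP => iq.
    apply: horner_eval_eq0; have := congr1 (fun p : {poly F} => p`_i) q0'.
    by rewrite coef_map coef0.
  by rewrite nth_default ?mulr0.
have q1_neq0 : q1 != 0 by apply: contraNneq q0 => q1E; rewrite qE q1E scaler0.
have lc1 : lead_coef q1 != 0 by rewrite lead_coef_eq0.
have [|k [q' [q1E q'0]]] := IHN q1 _ q1_neq0.
  by move: qN; rewrite qE lead_coefZ mulrC size_Mmonic ?monicXsubC // size_XsubC addn2.
by exists k.+1, q'; rewrite exprS -scalerA -q1E.
Qed.

Variable n : nat.
Implicit Types (P Q : mpoly.mpoly n {poly F}).

Lemma ev_eq0 d Q : Q \is mpoly.ishomog1 d (@mpoly.mdeg n) ->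
  mpoly.map_mpoly (horner_eval alpha) Q = 0 ->
  exists2 C, C \is mpoly.ishomog1 d (@mpoly.mdeg n) & Q = mpoly.mpolyC n X * C.
Proof.
move=> /mpoly.dhomogP Qd Q0.
exists (\sum_(m <- mpoly.msupp Q) (mpoly.mcoeff m Q %/ X) *: mpoly.mpolyX _ m).
  rewrite big_seq; apply: rpred_sum => m mQ.
  by apply: mpoly.dhomogZ; rewrite mpoly.dhomogX; apply/eqP/Qd.
rewrite {1}[Q]mpoly.mpolyE mulr_sumr; apply: eq_bigr => m _.
rewrite mpoly.mul_mpolyC scalerA; congr (_ *: _); apply: horner_eval_eq0.
have := congr1 (mpoly.mcoeff m) Q0.
by rewrite mpoly.mcoeff_map_mpoly mpoly.mcoeff0.
Qed.

Lemma ev_homog d Q : Q \is mpoly.ishomog1 d (@mpoly.mdeg n) ->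
  mpoly.map_mpoly (horner_eval alpha) Q \is mpoly.ishomog1 d (@mpoly.mdeg n).
Proof.
move=> /mpoly.dhomogP Qd; apply/mpoly.dhomogP => m.
rewrite mpoly.mcoeff_msupp mpoly.mcoeff_map_mpoly => Qm; apply: Qd.
by rewrite mpoly.mcoeff_msupp; apply: contraNneq Qm => ->; rewrite raddf0.
Qed.

End SpecializedPolynomials.

(** * Algebraic elements of the function field *)

Lemma homogenized_horner (A : nzRingType) (K : fieldType) (g : {additive A -> K})
    (q : {poly A}) (a b : K) : b != 0 ->
  \sum_(i < size q) g q`_i * a ^+ i * b ^+ ((size q).-1 - i) =
  b ^+ (size q).-1 * (map_poly g q).[a / b].
Proof.
move=> b0; rewrite /map_poly horner_poly mulr_sumr; apply: eq_bigr => i _.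
have iq : (i <= (size q).-1)%N by have := ltn_ord i; lia.
rewrite expr_div_n -[in RHS](subnK iq) exprD; field.
by rewrite expf_neq0.
Qed.

Section AlgebraicElements.
Variables (F L : fieldType) (j : {rmorphism F -> L}) (alpha : F) (n : nat).
Variables (u : 'I_n -> fps F) (v : 'I_n -> L).
Hypothesis F_closed : GRing.closed_field_axiom F.

Local Notation X := ('X - alpha%:P).
Local Notation Phi := (mpoly.mmap poly_fps u).
Local Notation Psi := (mpoly.mmap j v).
Local Notation eva := (mpoly.map_mpoly (horner_eval alpha)).
Local Notation homog d P := (P \is mpoly.ishomog1 d (@mpoly.mdeg n)).

(** [spec] is the inclusion given by analytic continuation; [lift] is the failure of the theorem,
    from which [k(z)] is shown to be algebraically closed in the function field. *)
Hypothesis spec : forall Q : mpoly.mpoly n {poly F},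
  Phi Q = 0 -> Psi (eva Q) = 0.
Hypothesis lift : forall P : mpoly.mpoly n F, homogeneous P -> Psi P = 0 ->
  exists Q : mpoly.mpoly n {poly F}, [/\ homogeneous Q, Phi Q = 0 & eva Q = P].

(** Lifting the relation [eva Q] to some [Q1] makes [Q - Q1] vanish at [alpha], hence divisible by
    [X], without changing [Phi Q]. *)
Lemma divisible_combination d (Q : mpoly.mpoly n {poly F}) :
  homog d Q -> Psi (eva Q) = 0 ->
  exists2 C, homog d C & Phi Q = poly_fps X * Phi C.
Proof.
move=> Qd PQ; have evd := ev_homog alpha Qd.
have [Q1 [Q1d Q10 Q1E]] : exists Q1 : mpoly.mpoly n {poly F},
    [/\ homog d Q1, Phi Q1 = 0 & eva Q1 = eva Q].
  have [Q1 [[e Q1e] Q10 Q1E]] := lift (ex_intro _ d evd) PQ.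
  (* The lift may have another degree only if [eva Q] is zero, and then 0 lifts it as well. *)
  have [ed|ed] := eqVneq e d; first by exists Q1; rewrite -ed.
  have [evQ0|evQ0] := eqVneq (eva Q) 0.
    by exists 0; split; rewrite ?rmorph0 // rpred0.
  case/eqP: ed; apply: mpoly.dhomog_uniq evQ0 _ evd.
  by rewrite -Q1E; apply: ev_homog.
have [||C Cd QE] := @ev_eq0 _ alpha n d (Q - Q1).
- by rewrite rpredB.
- by rewrite rmorphB /= Q1E subrr.
exists C => //; rewrite -[LHS]subr0 -Q10 -rmorphB QE rmorphM /=.
by rewrite mpoly.mmapC.
Qed.

Definition independent_forms (a b : fps F) : Prop := forall p q,
  poly_fps p * a + poly_fps q * b = 0 -> p = 0 /\ q = 0.

(** The pairs on which the descent runs; with [d] fixed, they all live in one finitely generated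
    module. *)
Definition algebraic_pair d (a b : fps F) : Prop :=
  [/\ exists2 A, homog d A & a = Phi A, exists2 B, homog d B & b = Phi B,
      independent_forms a b & algebraicOver ratfun_fps (a%:F / b%:F)].

Lemma independent_forms_neq0 a b : independent_forms a b -> b != 0.
Proof.
move=> ab; apply/eqP => b0; have [_ /eqP] : (0 : {poly F}) = 0 /\ (1 : {poly F}) = 0.
  by apply: ab; rewrite b0 rmorph0 mul0r mulr0 addr0.
by rewrite oner_eq0.
Qed.

Local Notation iota := (@FracField.tofrac (fps F) \o @poly_fps F).

Lemma algebraic_primitive_root (x : {fraction fps F}) :
  algebraicOver ratfun_fps x ->
  exists2 q : {poly {poly F}}, map_poly (horner_eval alpha) q != 0 &
    (map_poly iota q).[x] = 0.
Proof.
move=> [p p0 /rootP px]; have [d d0 [q1 pE]] := clear_denominators p.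
have q10 : q1 != 0.
  apply: contraNneq p0 => q10; move: pE; rewrite q10 rmorph0 => /eqP.
  by rewrite scaler_eq0 tofrac_eq0 (negPf d0).
have [k [q [q1E q0]]] := primitive_part alpha q10; exists q => //.
have q1E' : map_poly iota q1 = ratfun_fps d%:F *: map_poly ratfun_fps p.
  rewrite -map_polyZ pE -map_poly_comp; apply: eq_map_poly => c.
  exact/esym/ratfun_fps_tofrac.
have := congr1 (horner^~ x) q1E'; rewrite hornerZ px mulr0 q1E map_polyZ hornerZ.
move=> /eqP; rewrite mulf_eq0 => /orP[|/eqP //].
by rewrite /= tofrac_eq0 poly_fps_eq0 expf_eq0 polyXsubC_eq0 andbF.
Qed.

Lemma algebraic_pair_relation (a b : fps F) : b != 0 ->
  algebraicOver ratfun_fps (a%:F / b%:F) ->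
  exists2 q : {poly {poly F}}, map_poly (horner_eval alpha) q != 0 &
    \sum_(i < size q) poly_fps q`_i * a ^+ i * b ^+ ((size q).-1 - i) = 0.
Proof.
move=> b0 /algebraic_primitive_root[q q0 qx]; exists q => //.
have bF0 : b%:F != 0 by rewrite tofrac_eq0.
have H := @homogenized_horner _ _ iota q a%:F b%:F bF0.
rewrite qx mulr0 in H; apply/eqP; rewrite -tofrac_eq0 rmorph_sum /= -[X in _ == X]H.
by apply/eqP; apply: eq_bigr => i _; rewrite !rmorphM !rmorphXn.
Qed.

(* A primitive algebraic relation between [a] and [b] specializes to a nonzero
   binary form over [F] vanishing at the values of [A] and [B]; as [F] is
   algebraically closed, it splits into linear forms, one of which vanishes. *)
Lemma algebraic_pair_step d a b : algebraic_pair d a b -> exists c,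
  (b = poly_fps X * c /\ algebraic_pair d a c) \/
  (exists gamma, a - poly_fps gamma * b = poly_fps X * c /\ algebraic_pair d c b).
Proof.
move=> [[A Ad aE] [B Bd bE] ab algab]; have b0 := independent_forms_neq0 ab.
have X0 : poly_fps X != 0 by rewrite poly_fps_eq0 polyXsubC_eq0.
have algX : algebraicOver ratfun_fps (poly_fps X)%:F.
  by rewrite -ratfun_fps_tofrac; apply: algebraic_id.
have [PB0|PB0] := eqVneq (Psi (eva B)) 0.
  have [C Cd] := divisible_combination Bd PB0; rewrite -bE => bXC.
  exists (Phi C); left; split; first exact: bXC.
  split; [by exists A|by exists C| |].
    move=> p q pq; have [] := ab (p * X) q.
      rewrite bXC rmorphM /= -[RHS](mulr0 (poly_fps X)) -pq; ring.
    by move=> /eqP; rewrite mulf_eq0 polyXsubC_eq0 orbF => /eqP.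
  have -> : a%:F / (Phi C)%:F = (poly_fps X)%:F * (a%:F / b%:F).
    have C0 : Phi C != 0 by apply: contraNneq b0 => C0; rewrite bXC C0 mulr0.
    rewrite mulrA [in RHS]bXC -!rmorphM; apply/eqP.
    rewrite eqr_div ?tofrac_eq0 ?mulf_neq0 // -!rmorphM; apply/eqP.
    by congr (_%:F); ring.
  exact: (algebraic_mul algX algab).
have [q q0 qab] := algebraic_pair_relation b0 algab.
pose Q := \sum_(i < size q) mpoly.mpolyC n q`_i * A ^+ i * B ^+ ((size q).-1 - i).
have PhiQ : Phi Q = 0.
  rewrite -qab rmorph_sum; apply: eq_bigr => i _.
  by rewrite !rmorphM !rmorphXn /= mpoly.mmapC aE bE.
(* This quotient is a root of the specialized equation of [a / b], so it comes from [F]. *)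
have [g gE] : exists g, Psi (eva A) / Psi (eva B) = j g.
  apply: (closed_root_descends F_closed q0); rewrite -map_poly_comp rootE.
  rewrite -(mulrI_eq0 _ (mulfI (expf_neq0 (size q).-1 PB0))).
  rewrite -homogenized_horner // -[X in _ == X](spec PhiQ); apply/eqP.
  rewrite [X in _ = mpoly.mmap _ _ X]rmorph_sum [RHS]rmorph_sum.
  apply: eq_bigr => i _; rewrite !rmorphM /= mpoly.map_mpolyC mpoly.mmapC.
  by congr (_ * _ * _); rewrite [in RHS]rmorphXn [RHS]rmorphXn.
pose D := A - mpoly.mpolyC n g%:P * B.
have Dd : homog d D.
  by rewrite /D mpoly.mul_mpolyC rpredB // mpoly.dhomogZ.
have PD0 : Psi (eva D) = 0.
  rewrite !rmorphB !rmorphM /= mpoly.map_mpolyC mpoly.mmapC /= /horner_eval hornerC.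
  by rewrite -gE divfK ?subrr.
have [C Cd CE] := divisible_combination Dd PD0.
have abC : a - poly_fps g%:P * b = poly_fps X * Phi C.
  by rewrite -CE rmorphB rmorphM /= mpoly.mmapC aE bE.
exists (Phi C); right; exists g%:P; split; first exact: abC.
split; [by exists C|by exists B| |].
  move=> p r pr; have [] := ab p (r * X - p * g%:P).
    rewrite rmorphB !rmorphM /= -[RHS](mulr0 (poly_fps X)) -pr mulrDr.
    by rewrite mulrCA -abC; ring.
  move=> -> /eqP; rewrite mul0r subr0 mulf_eq0 polyXsubC_eq0 orbF => /eqP rE.
  by rewrite rE.
have -> : (Phi C)%:F / b%:F = (a%:F / b%:F - (poly_fps g%:P)%:F) / (poly_fps X)%:F.
  have bF0 : b%:F != 0 by rewrite tofrac_eq0.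
  have XF0 : (poly_fps X)%:F != 0 by rewrite tofrac_eq0.
  apply: (mulIf XF0); rewrite [RHS]divfK // mulrAC -rmorphM (mulrC (Phi C)) -abC.
  by rewrite rmorphB rmorphM /= mulrBl mulfK.
have algg : algebraicOver ratfun_fps (poly_fps g%:P)%:F.
  by rewrite -ratfun_fps_tofrac; apply: algebraic_id.
exact: (algebraic_div (algebraic_sub algab algg) algX).
Qed.

(** The graded piece lies in the [F[z]]-span of the images of the monomials of degree at most [d], a
    finite family. *)
Lemma algebraic_pair_absurd d a b : ~ algebraic_pair d a b.
Proof.
pose e (m : mpoly.bmultinom n d.+1) := Phi (mpoly.mpolyX {poly F} m).
apply: (no_infinite_descent (alpha := alpha) (e := e)); last exact: algebraic_pair_step.
have sp (A : mpoly.mpoly n {poly F}) : homog d A -> fps_span e (Phi A).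
  move=> /mpoly.dhomogP Ad; exists (fun m : mpoly.bmultinom n d.+1 => mpoly.mcoeff (mpoly.bmnm m) A).
  rewrite {1}(@mpoly.mpolywE _ _ d.+1 A).
    rewrite rmorph_sum; apply: eq_bigr => m _.
    by rewrite -mpoly.mul_mpolyC rmorphM /= mpoly.mmapC.
  by rewrite mpoly.msizeE; apply/bigmax_leqP_seq => m mA _; rewrite Ad.
by move=> {}a {}b [[A Ad ->] [B Bd ->] AB _]; split=> //; apply: sp.
Qed.

Lemma algebraic_quotient d A B : homog d A -> homog d B -> Phi B != 0 ->
  algebraicOver ratfun_fps ((Phi A)%:F / (Phi B)%:F) ->
  range ratfun_fps ((Phi A)%:F / (Phi B)%:F).
Proof.
move=> Ad Bd B0 algAB; apply: contrapT => not_rat.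
apply: (@algebraic_pair_absurd d (Phi A) (Phi B)).
split=> //; [by exists A|by exists B|] => p q pq.
(* A relation with [p] nonzero would make the quotient equal to [- q / p], a rational function. *)
have p0 : p = 0.
  apply/eqP/negPn/negP => p0; apply: not_rat; exists (- q%:F / p%:F) => //.
  rewrite -rmorphN ratfun_fpsE // rmorphN; apply/eqP.
  rewrite eqr_div ?tofrac_eq0 ?poly_fps_eq0 // -!rmorphM tofrac_eq.
  by move/eqP: pq; rewrite addr_eq0 mulNr [Phi A * _]mulrC eq_sym.
split=> //; move/eqP: pq; rewrite p0 rmorph0 mul0r add0r mulf_eq0 (negPf B0) orbF.
by rewrite poly_fps_eq0 => /eqP.
Qed.

End AlgebraicElements.

(** * Separable generation of the function field *)

Section Substitution.

Lemma mpoly_ring_ind (A : comNzRingType) n (K : mpoly.mpoly n A -> Prop) :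
  (forall c, K (mpoly.mpolyC n c)) ->
  (forall i, K (mpoly.mpolyX A (mpoly.mnm1 i))) ->
  (forall P Q, K P -> K Q -> K (P + Q)) ->
  (forall P Q, K P -> K Q -> K (P * Q)) -> forall P, K P.
Proof.
move=> KC KX KD KM P; rewrite [P]mpoly.mpolyE.
have K0 : K 0 by have := KC 0; rewrite rmorph0.
have K1 : K 1 by have := KC 1; rewrite rmorph1.
apply: (big_ind K) => // m _; rewrite -mpoly.mul_mpolyC; apply: (KM) => //.
rewrite mpoly.mpolyXE_id; apply: (big_ind K) => // i _.
by elim: (m i) => [|k IHk]; rewrite ?expr0 // exprS; apply: KM.
Qed.

Variables (A : comNzRingType) (K : fieldType) (g : {rmorphism A -> K}) (n : nat).
Variables (w : 'I_n -> K) (i : 'I_n).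

(** Turns a relation between series into a univariate polynomial with root [w i], simple when the
    partial derivative does not vanish, as [separable_over_simple_root] requires. *)
Definition one_variable (P : mpoly.mpoly n A) : {poly K} :=
  mpoly.mmap (polyC \o g) (fun l => if l == i then 'X else (w l)%:P) P.

Lemma one_variable_horner P : (one_variable P).[w i] = mpoly.mmap g w P.
Proof.
rewrite -[LHS]/(horner_eval (w i) (one_variable P)) rmorph_mmap.
congr (mpoly.mmap _ _ P); apply/funext => x /=.
  by rewrite /horner_eval hornerC.
by rewrite /horner_eval; case: eqP => [->|_]; rewrite ?hornerX ?hornerC.
Qed.

Lemma one_variable_deriv P :
  (one_variable P)^`() = one_variable (mpoly.mderiv i P).
Proof.
rewrite /one_variable; elim/mpoly_ring_ind: P => [c|l|P Q IHP IHQ|P Q IHP IHQ].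
- by rewrite mpoly.mmapC mpoly.mderivC rmorph0 /= derivC.
- rewrite mpoly.mmapX mpoly.mmap1U mpoly.mderivX mpoly.mnm1E eq_sym.
  have [<-|_] := eqVneq l i.
    rewrite derivX scale1r mpoly.mmapX (_ : mpoly.mnm_sub _ _ = mpoly.mnm0).
      by rewrite mpoly.mmap11.
    by apply/mpoly.mnmP => l'; rewrite mpoly.mnmBE subnn mpoly.mnm0E.
  by rewrite derivC scale0r rmorph0.
- by rewrite mpoly.mderivD !rmorphD /= derivD IHP IHQ.
- by rewrite mpoly.mderivM rmorphD !rmorphM /= derivM IHP IHQ.
Qed.

Lemma one_variable_over (S : sfield K) P : (forall a, sf_set S (g a)) ->
  (forall l, l != i -> sf_set S (w l)) ->
  one_variable P \is a polyOver (mem (sf_set S)).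
Proof.
move=> gS wS; suff : one_variable P \is a polyOver (sf_mem S) by [].
rewrite /one_variable; elim/mpoly_ring_ind: P => [c|l|P Q IHP IHQ|P Q IHP IHQ].
- by rewrite mpoly.mmapC polyOverC; apply/mem_set/gS.
- rewrite mpoly.mmapX mpoly.mmap1U; have [_|/wS Sl] := eqVneq l i.
    exact: polyOverX.
  by rewrite polyOverC; apply/mem_set.
- by rewrite rmorphD rpredD.
- by rewrite rmorphM rpredM.
Qed.

End Substitution.

Lemma separable_overS (M : fieldType) (S S' : sfield M) (x : M) :
  sf_set S `<=` S' -> separable_over S x -> separable_over S' x.
Proof.
move=> SS' [p [/polyOver_memP pS p_sep px]]; exists p; split=> //.
by apply/polyOver_memP => i; apply: SS'.
Qed.

Section FunctionField.
Variables (F : fieldType) (n : nat) (f : 'I_n -> fps F).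

Local Notation iota := (@FracField.tofrac (fps F) \o @poly_fps F).
Local Notation Phi := (mpoly.mmap poly_fps (cons1 f)).
Local Notation homog d P := (P \is mpoly.ishomog1 d (@mpoly.mdeg n.+1)).

(** Since [X_0] takes the value 1, each generator [f_k] is the value of [X_k / X_0]; quotients of
    forms of equal degree are closed under the field operations. *)
Lemma function_field_quotient x : function_field f x ->
  exists d (A B : mpoly.mpoly n.+1 {poly F}), [/\ homog d A, homog d B, Phi B != 0 &
    x = (Phi A)%:F / (Phi B)%:F].
Proof.
have Phi1 : Phi 1 = 1 by exact: rmorph1.
have hC c : homog 0%N (mpoly.mpolyC n.+1 c : mpoly.mpoly n.+1 {poly F}).
  by rewrite -[mpoly.mpolyC _ c]mulr1 mpoly.mul_mpolyC mpoly.dhomogZ // mpoly.dhomog1.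
pose K x := exists d (A B : mpoly.mpoly n.+1 {poly F}),
  [/\ homog d A, homog d B, Phi B != 0 & x = (Phi A)%:F / (Phi B)%:F].
suff : function_field f `<=` K by apply.
apply: subfield_gen_sub.
  apply/is_subfieldP; split.
  - exists 0%N, 1, 1; rewrite Phi1; split; rewrite ?mpoly.dhomog1 ?oner_neq0 //.
    by rewrite divff // tofrac_eq0 oner_neq0.
  - move=> _ _ [d [A [B [Ad Bd B0 ->]]]] [e [C [D [Ce De D0 ->]]]].
    exists (d + e)%N, (A * D - B * C), (B * D); split.
    + by rewrite rpredB ?mpoly.dhomogM.
    + exact: mpoly.dhomogM.
    + by rewrite rmorphM mulf_neq0.
    have -> : Phi (A * D - B * C) = Phi A * Phi D - Phi C * Phi B.
      by rewrite rmorphB !rmorphM (mulrC (Phi B)).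
    have -> : Phi (B * D) = Phi B * Phi D by rewrite rmorphM.
    by rewrite rmorphB !rmorphM /= -!mulNr addf_div ?tofrac_eq0.
  - move=> _ _ [d [A [B [Ad Bd B0 ->]]]] [e [C [D [Ce De D0 ->]]]].
    (* Division by zero yields 0, which is written as [0 / 1]. *)
    have [C0|C0] := eqVneq (Phi C) 0.
      exists 0%N, 0, 1; rewrite Phi1; split; rewrite ?rpred0 ?mpoly.dhomog1 ?oner_neq0 //.
      by rewrite C0 !rmorph0 !mul0r invr0 mulr0.
    exists (d + e)%N, (A * D), (B * C); split; try exact: mpoly.dhomogM.
      by rewrite rmorphM mulf_neq0.
    have -> : Phi (A * D) = Phi A * Phi D by rewrite rmorphM.
    have -> : Phi (B * C) = Phi B * Phi C by rewrite rmorphM.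
    by rewrite invf_div mulf_div !rmorphM.
move=> _ [[y _ <-]|[k _ <-]].
  have [a [b [b0 ->]]] := fraction_exists y.
  exists 0%N, (mpoly.mpolyC _ a), (mpoly.mpolyC _ b); split=> //.
    by rewrite mpoly.mmapC poly_fps_eq0.
  by rewrite !mpoly.mmapC ratfun_fpsE.
exists 1%N, (mpoly.mpolyX _ (mpoly.mnm1 (lift ord0 k))),
  (mpoly.mpolyX _ (mpoly.mnm1 ord0)).
have Phi0 : Phi (mpoly.mpolyX _ (mpoly.mnm1 ord0)) = 1.
  by rewrite mpoly.mmapX mpoly.mmap1U /cons1 unlift_none.
rewrite Phi0; split; rewrite ?oner_neq0 //.
- by rewrite mpoly.dhomogX; apply/eqP/mpoly.mdeg1.
- by rewrite mpoly.dhomogX; apply/eqP/mpoly.mdeg1.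
by rewrite tofrac1 divr1 mpoly.mmapX mpoly.mmap1U /cons1 liftK.
Qed.

(** The powers of [z] are infinitely many elements of [S], more than [r] has roots. *)
Lemma ratfun_large (S : sfield {fraction fps F}) :
  range ratfun_fps `<=` S -> forall r : {poly {fraction fps F}}, r != 0 ->
  exists2 t, sf_set S t & ~~ root r t.
Proof.
move=> FS r r0; apply: contrapT => no_t.
pose s := [seq iota 'X^k | k <- seq.iota 0 (size r)].
have s_root : all (root r) s.
  apply/allP => _ /mapP[k _ ->]; apply/negPn/negP => rk; apply: no_t.
  exists (iota 'X^k) => //; apply: FS; exists ('X^k)%:F => //.
  exact: ratfun_fps_tofrac.
have s_uniq : uniq s.
  rewrite map_inj_uniq ?iota_uniq // => k l /eqP; rewrite /= tofrac_eq => /eqP/poly_fps_inj kl.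
  by have := congr1 (size \o polyseq) kl; rewrite /= !size_polyXn => -[].
by have := max_poly_roots r0 s_root s_uniq; rewrite size_map size_iota ltnn.
Qed.

Definition basis_field (T : {set 'I_n}) : sfield {fraction fps F} :=
  SField (subfield_genP (range (@ratfun_fps F) `|`
    [set x | exists2 k, k \in T & x = (f k)%:F])).

Lemma sub_basis_field T : range (@ratfun_fps F) `<=` basis_field T.
Proof. by move=> x Fx; apply: sub_subfield_gen; left. Qed.

Lemma mem_basis_field (T : {set 'I_n}) k :
  k \in T -> sf_set (basis_field T) (f k)%:F.
Proof. by move=> kT; apply: sub_subfield_gen; right; exists k. Qed.

Definition separating T :=
  forall k, separable_over (basis_field T) (f k)%:F.

(** Once [f i] is separable over the others, the field of [T] lies in a separable extension of that
    of [T :\ i], and transitivity applies. *)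
Lemma separating_exchange (T : {set 'I_n}) i : i \in T -> separating T ->
  separable_over (basis_field (T :\ i)) (f i)%:F -> separating (T :\ i).
Proof.
move=> iT sepT sep_i k.
have large := ratfun_large (@sub_basis_field (T :\ i)).
apply: (separable_over_trans large sep_i).
pose S' := SField (subfield_genP (basis_field (T :\ i) `|` [set (f i)%:F])).
apply: (@separable_overS _ _ S') (sepT k).
apply: subfield_gen_sub (subfield_genP _) _ => x [Fx|[l lT ->]].
  by apply: sub_subfield_gen; left; apply: sub_basis_field.
have [->|li] := eqVneq l i; first by apply: sub_subfield_gen; right.
apply: sub_subfield_gen; left; apply: mem_basis_field.
by rewrite finset.in_setD1 li.
Qed.

(* A polynomial relation of minimal degree has a nonzero partial derivative,
   hence exhibits one of the series as a simple root over the others. *)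
Lemma minimal_separating_free (T : {set 'I_n}) (t : 'I_#|T| -> 'I_n) :
  GRing.closed_field_axiom F -> separating T ->
  (forall i, i \in T -> ~ separating (T :\ i)) ->
  injective t -> (forall l, t l \in T) ->
  (forall k, k \in T -> exists l, t l = k) ->
  forall P : mpoly.mpoly #|T| {poly F},
    mpoly.mmap poly_fps (f \o t) P = 0 -> P = 0.
Proof.
move=> F_closed sepT minT t_inj tT t_surj P0 P00; apply/eqP/negPn/negP => P0_neq0.
have [P [l [P_0 P'0]]] := separable_relation F_closed (ex_intro2 _ _ P0 P0_neq0 P00).
pose w := @FracField.tofrac _ \o (f \o t); pose h := one_variable iota w l P.
apply: (minT (t l) (tT l)); apply: separating_exchange => //.
apply: (@separable_over_simple_root _ _ h).
- apply: one_variable_over => [a|k kl].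
    apply: sub_basis_field; exists a%:F => //; exact: ratfun_fps_tofrac.
  apply: mem_basis_field; rewrite finset.in_setD1 tT andbT.
  by apply: contraNneq kl => /t_inj ->.
- rewrite rootE -[(f (t l))%:F]/(w l) one_variable_horner.
  by rewrite -(rmorph_mmap _ poly_fps (f \o t)) P_0 rmorph0.
rewrite rootE one_variable_deriv -[(f (t l))%:F]/(w l) one_variable_horner.
by rewrite -(rmorph_mmap _ poly_fps (f \o t)) tofrac_eq0.
Qed.

Lemma ratfun_common_denominator (s : seq {fraction fps F}) :
  {in s, forall c, range ratfun_fps c} -> exists2 d : {poly F}, d != 0 &
    forall c, c \in s -> exists a, iota d * c = iota a.
Proof.
elim: s => [|c s IHs] sF; first by exists 1; rewrite ?oner_neq0.
have [|d d0 dE] := IHs; first by move=> b bs; apply: sF; rewrite inE bs orbT.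
have [x _ xE] := sF c (mem_head _ _); have [a [b [b0 xab]]] := fraction_exists x.
exists (b * d) => [|c']; first by rewrite mulf_neq0.
rewrite inE => /orP[/eqP ->|/dE[a' a'E]].
  exists (d * a); have bF0 : iota b != 0 by rewrite /= tofrac_eq0 poly_fps_eq0.
  have -> : iota (b * d) = iota d * iota b by rewrite mulrC rmorphM.
  have -> : c = iota a / iota b by rewrite -xE xab ratfun_fpsE.
  by rewrite -mulrA [X in _ * X]mulrC divfK // -rmorphM.
exists (b * a'); have -> : iota (b * d) = iota b * iota d by rewrite rmorphM.
by rewrite -mulrA a'E -rmorphM.
Qed.

(** A common denominator turns a relation over [k(z)] into one over [k[z]]. *)
Lemma alg_independent_ratfun r (t : 'I_r -> fps F) :
  (forall P : mpoly.mpoly r {poly F}, mpoly.mmap poly_fps t P = 0 -> P = 0) ->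
  alg_independent (range (@ratfun_fps F)) (fun l => (t l)%:F).
Proof.
move=> freet P PF0 P0.
have /mpoly.mpolyOverP PF :
  P \is a mpoly.mpolyOver r (sf_mem (SField (@ratfun_subfield F))) := PF0.
pose s := [seq mpoly.mcoeff m P | m <- mpoly.msupp P].
have [|d d0 dE] := @ratfun_common_denominator s.
  by move=> _ /mapP[m _ ->]; have := PF m; rewrite inE.
have /choice[a aE] m : exists a, m \in mpoly.msupp P -> iota d * mpoly.mcoeff m P = iota a.
  have [mP|_] := boolP (m \in mpoly.msupp P); last by exists 0.
  by have [a aE] := dE _ (map_f (fun m => mpoly.mcoeff m P) mP); exists a.
pose P' := \sum_(m <- mpoly.msupp P) a m *: mpoly.mpolyX {poly F} m.
have P'0 : P' = 0.
  apply: freet; apply/eqP; rewrite -tofrac_eq0 rmorph_mmap.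
  have -> : mpoly.mmap iota (@FracField.tofrac _ \o t) P' =
      iota d * mpoly.meval (fun l => (t l)%:F) P.
    rewrite /P' rmorph_sum mpoly.mevalE mulr_sumr /= big_seq [RHS]big_seq.
    apply: eq_bigr => m mP; rewrite -mpoly.mul_mpolyC rmorphM /= mpoly.mmapC.
    by rewrite mpoly.mmapX mulrA aE.
  by rewrite P0 mulr0.
apply/mpoly.mpolyP => m; rewrite mpoly.mcoeff0; apply/eqP/negPn/negP.
rewrite -mpoly.mcoeff_msupp => mP; have := congr1 (mpoly.mcoeff m) P'0.
rewrite mpoly.mcoeff0 /P' raddf_sum /= (bigD1_seq m) ?mpoly.msupp_uniq //=.
rewrite mpoly.mcoeffZ mpoly.mcoeffX eqxx mulr1 big1 => [|m' /negPf m'm]; last first.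
  by rewrite mpoly.mcoeffZ mpoly.mcoeffX m'm mulr0.
rewrite addr0 => am0; move: (aE m mP) => /eqP; rewrite am0 rmorph0 mulf_eq0.
rewrite /= tofrac_eq0 poly_fps_eq0 (negPf d0) /=.
by move: mP; rewrite mpoly.mcoeff_msupp => /negPf ->.
Qed.

(** Among the sets [T] over which all the series are separable, one of least cardinality is taken;
    no element can be removed from it, which makes it algebraically free. *)
Lemma separably_generated : GRing.closed_field_axiom F ->
  exists (r : nat) (t : 'I_r -> {fraction fps F}),
    [/\ range t `<=` function_field f,
       alg_independent (range (@ratfun_fps F)) t &
       forall x, function_field f x -> separable_over
         (subfield_gen (range (@ratfun_fps F) `|` range t)) x].
Proof.
move=> F_closed.
have exT : exists m, `[< exists2 T : {set 'I_n}, #|T| = m & separating T >].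
  exists #|finset.setTfor 'I_n|; apply/asboolP; exists (finset.setTfor 'I_n) => // k.
  by apply: separable_over_base; apply: mem_basis_field; rewrite finset.inE.
case: (ex_minnP exT) => m /asboolP[T Tm sepT] m_min.
pose t : 'I_#|T| -> 'I_n := @enum_val _ (mem T).
have t_surj k : k \in T -> exists l, t l = k.
  by move=> kT; exists (enum_rank_in kT k); apply: enum_rankK_in.
have range_t : range (fun l => (f (t l))%:F) =
    [set x | exists2 k, k \in T & x = (f k)%:F].
  apply/seteqP; split=> [_ [l _ <-]|_ [k kT ->]].
    by exists (t l) => //; apply: enum_valP.
  by have [l <-] := t_surj k kT; exists l.
exists #|T|, (fun l => (f (t l))%:F); split.
- by move=> _ [l _ <-]; apply: sub_subfield_gen; right; exists (t l).
- apply: (alg_independent_ratfun (t := f \o t)).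
  apply: (minimal_separating_free F_closed sepT) => // [i iT sep_i|l l'|l].
  + have : (m <= #|T :\ i|)%N by apply: m_min; apply/asboolP; exists (T :\ i).
    by rewrite -Tm (cardsD1 i T) iT add1n ltnn.
  + exact: enum_val_inj.
  + exact: enum_valP.
(* Separable elements form a field, so only the generators have to be checked. *)
rewrite range_t; apply: subfield_gen_sub.
  exact: (separable_over_subfield (ratfun_large (@sub_basis_field T))).
move=> _ [[x _ <-]|[k _ <-]]; last exact: sepT.
by apply: (@separable_over_base _ (basis_field T)); apply: sub_basis_field; exists x.
Qed.

End FunctionField.

(** * Homogenization *)

Section HomogeneousComponents.
Variable n : nat.
Local Notation comp d Q := (mpoly.pihomog (@mpoly.mdeg n) d Q).

Lemma mcoeff_pihomog (A : nzRingType) d (Q : mpoly.mpoly n A) m :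
  mpoly.mcoeff m (comp d Q) = if mpoly.mdeg m == d then mpoly.mcoeff m Q else 0.
Proof.
rewrite mpoly.pihomogE raddf_sum /= big_mkcond /=.
have [mQ|mQ] := boolP (m \in mpoly.msupp Q).
  rewrite (bigD1_seq m) ?mpoly.msupp_uniq //= big1 => [|m' /negPf m'm].
    by rewrite addr0 mpoly.mcoeffZ mpoly.mcoeffX eqxx mulr1.
  by rewrite mpoly.mcoeffZ mpoly.mcoeffX m'm mulr0 if_same.
rewrite big_seq big1 => [|m' m'Q].
  by move: mQ; rewrite mpoly.mcoeff_msupp negbK => /eqP ->; rewrite if_same.
rewrite mpoly.mcoeffZ mpoly.mcoeffX (negPf (_ : m' != m)) ?mulr0 ?if_same //.
by apply: contraNneq mQ => <-.
Qed.

Lemma map_mpoly_pihomog (A B : nzRingType) (g : {additive A -> B}) d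
    (Q : mpoly.mpoly n A) :
  mpoly.map_mpoly g (comp d Q) = comp d (mpoly.map_mpoly g Q).
Proof.
apply/mpoly.mpolyP => m; rewrite mpoly.mcoeff_map_mpoly !mcoeff_pihomog.
by rewrite mpoly.mcoeff_map_mpoly; case: eqP; rewrite ?raddf0.
Qed.

Lemma pihomog_sum (A : nzRingType) (Q : mpoly.mpoly n A) :
  Q = \sum_(d < mpoly.mmeasure mpoly.mdeg Q) comp d Q.
Proof. exact: mpoly.pihomog_partitionE. Qed.

Lemma pihomog_big (A : nzRingType) d I (r : seq I) (G : I -> mpoly.mpoly n A) :
  comp d (\sum_(i <- r) G i) = \sum_(i <- r) comp d (G i).
Proof. exact: (raddf_sum (mpoly.pihomog (@mpoly.mdeg n) d)). Qed.

End HomogeneousComponents.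

Section HomogenizedRelations.
Variables (A : comNzRingType) (C : comNzRingType) (g : {rmorphism A -> C}).
Variables (n : nat) (w : 'I_n -> C).

Local Notation q := [set Q : mpoly.mpoly n A | mpoly.mmap g w Q = 0].
Local Notation comp d Q := (mpoly.pihomog (@mpoly.mdeg n.+1) d Q).

Lemma mmap_dehomogenize (Q : mpoly.mpoly n.+1 A) :
  mpoly.mmap g w (dehomogenize Q) = mpoly.mmap g (cons1 w) Q.
Proof.
rewrite /dehomogenize rmorph_mmap cons1_comp ?rmorph1 //.
congr (mpoly.mmap _ (cons1 _) Q); apply/funext => x /=.
  exact: mpoly.mmapC.
by rewrite mpoly.mmapX mpoly.mmap1U.
Qed.

Lemma homogenize_ideal (I : set (mpoly.mpoly n A)) : is_ideal (homogenize I).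
Proof.
split=> [J [[]] //|x y Ix Iy J JI|a x Ix J JI].
- by have [_ JD _] := JI.1; apply: JD; [apply: Ix|apply: Iy].
- by have [_ _ JM] := JI.1; apply: JM; apply: Ix.
Qed.

(** Being generated by forms, the ideal contains the components of its elements; evaluating after
    dehomogenization is evaluating at [(1, w)]. *)
Lemma homogenizeP (Q : mpoly.mpoly n.+1 A) :
  homogenize q Q <-> forall d, mpoly.mmap g (cons1 w) (comp d Q) = 0.
Proof.
have [I0 ID _] := homogenize_ideal q; split=> [|Q0]; last first.
  rewrite (pihomog_sum Q); apply: (big_ind (homogenize q)) => // d _.
  apply: sub_gen_smallest; split; first by exists d; apply: mpoly.pihomogP.
  by rewrite /= mmap_dehomogenize.
pose J := [set Q | forall d, mpoly.mmap g (cons1 w) (comp d Q) = 0].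
suff : homogenize q `<=` J by apply.
apply: smallest_sub.
  split=> [d|P R PJ RJ d|P R RJ d]; first by rewrite mpoly.pihomog0 rmorph0.
    by rewrite mpoly.pihomogD rmorphD /= PJ RJ addr0.
  (* A component of [P * R] is a sum of products of components, and those of [R] are relations. *)
  rewrite (pihomog_sum P) mulr_suml pihomog_big rmorph_sum big1 // => e _.
  rewrite [X in _ * X](pihomog_sum R) mulr_sumr pihomog_big rmorph_sum big1 // => b _.
  have PR : comp e P * comp b R \is mpoly.ishomog1 (e + b) (@mpoly.mdeg n.+1).
    by apply: mpoly.dhomogM; apply: mpoly.pihomogP.
  have [<-|ebd] := eqVneq (e + b)%N d.
    by rewrite /= mpoly.pihomog_dE // rmorphM /= RJ mulr0.
  by rewrite /= (mpoly.pihomog_ne0 ebd) // rmorph0.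
move=> P [[e Pe] /= P0] d; rewrite mmap_dehomogenize in P0.
have [<-|ed] := eqVneq e d; first by rewrite mpoly.pihomog_dE.
by rewrite (mpoly.pihomog_ne0 ed) // rmorph0.
Qed.

End HomogenizedRelations.

(** * Comparison of the two homogenized ideals *)

Lemma contract_relationsP (F : fieldType) n (f : 'I_n -> fps F)
    (Q : mpoly.mpoly n.+1 {poly F}) :
  contract_to_poly (homogenize (function_relations f)) Q <->
  forall d, mpoly.mmap poly_fps (cons1 f) (mpoly.pihomog (@mpoly.mdeg _) d Q) = 0.
Proof.
have mmapE (P : mpoly.mpoly n.+1 {poly F}) :
    mpoly.mmap ratfun_fps (cons1 (fun k => (f k)%:F))
      (mpoly.map_mpoly (@FracField.tofrac {poly F}) P) =
    (mpoly.mmap poly_fps (cons1 f) P)%:F.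
  rewrite mmap_map_mpoly rmorph_mmap cons1_comp ?tofrac1 //.
  congr (mpoly.mmap _ _ P); apply/funext => a; exact: ratfun_fps_tofrac.
rewrite /contract_to_poly /= homogenizeP; split=> Q0 d; have := Q0 d.
  by rewrite -map_mpoly_pihomog mmapE => /eqP; rewrite tofrac_eq0 => /eqP.
by rewrite -map_mpoly_pihomog mmapE => ->; rewrite rmorph0.
Qed.

Lemma algebraic_over_ratfun (F : fieldType) (x : {fraction fps F}) :
  algebraic_over (range ratfun_fps) x -> algebraicOver ratfun_fps x.
Proof.
move=> [p [/(polyOver_memP (SField (@ratfun_subfield F))) pF p0 px]].
have /choice[c cE] i : exists a, ratfun_fps a = p`_i.
  by have [a _ <-] := pF i; exists a.
have pE : p = map_poly ratfun_fps (\poly_(i < size p) c i).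
  apply/polyP => i; rewrite coef_map coef_poly; case: ltnP => ip.
    exact/esym/cE.
  by rewrite nth_default ?raddf0.
exists (\poly_(i < size p) c i); last by rewrite -pE.
by apply: contraNneq p0 => c0; rewrite pE c0 rmorph0.
Qed.

Theorem theorem1p5 (R : realType) (K : valuedFieldType R) (Kbar : fieldType)
    (Kt : valuedFieldType R)
    (i : {rmorphism K -> Kbar}) (j : {rmorphism Kbar -> Kt})
    (n : nat) (f : 'I_n -> fps Kbar) (U : set Kt) (fU : 'I_n -> Kt -> Kt)
    (alpha : Kbar) :
  algebraic_closure i ->
  completed_algebraic_closure (j \o i) ->
  (forall k, convergent_near0 (j \o fps_coef (f k))) ->
  domain U ->
  U 0 ->
  (forall k, analytic_on U (fU k)) ->
  (forall k, expansion_at U (fU k) 0 (j \o fps_coef (f k))) ->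
  U (j alpha) ->
  ~ regular_extension (range (@ratfun_fps Kbar)) (function_field f) ->
  let values := fun k => fU k (j alpha) in
  ev alpha @` contract_to_poly (homogenize (function_relations f))
    `<` homogenize (value_relations j values)
  /\
  exists P : mpoly.mpoly n.+1 Kbar,
    [/\ homogeneous P,
        mpoly.mmap j (cons1 values) P = 0 &
        forall Q : mpoly.mpoly n.+1 {poly Kbar},
          homogeneous Q -> mpoly.mmap poly_fps (cons1 f) Q = 0 ->
          P <> ev alpha Q].
Proof.
move=> [Kbar_closed _] _ _ U_dom U0 fU_an fU0 Ua not_regular values.
have spec (Q : mpoly.mpoly n.+1 {poly Kbar}) :
    mpoly.mmap poly_fps (cons1 f) Q = 0 ->
    mpoly.mmap j (cons1 values) (mpoly.map_mpoly (horner_eval alpha) Q) = 0.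
  exact: relation_specializes U_dom U0 fU_an fU0 Ua.
have ex_P : exists P : mpoly.mpoly n.+1 Kbar,
    [/\ homogeneous P, mpoly.mmap j (cons1 values) P = 0 &
        forall Q : mpoly.mpoly n.+1 {poly Kbar},
          homogeneous Q -> mpoly.mmap poly_fps (cons1 f) Q = 0 ->
          P <> ev alpha Q].
  (* If every homogeneous relation lifts, both conditions for regularity hold: the first by
     separable generation, the second by descent. *)
  apply: contrapT => no_P; apply: not_regular; split.
    exact: separably_generated.
  move=> x /function_field_quotient[d [A [B [Ad Bd B0 ->]]]].
  move=> /algebraic_over_ratfun algAB.
  apply: (algebraic_quotient Kbar_closed spec _ Ad Bd B0 algAB) => P P_homog P0.
  apply: contrapT => no_Q; apply: no_P; exists P; split=> // Q Q_homog Q0 PE.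
  by apply: no_Q; exists Q; split.
(* The inclusion is checked on homogeneous components; it is strict because [P] is missed. *)
split=> //; have [P [[d Pd] P0 no_lift]] := ex_P; split.
  move=> _ [Q /contract_relationsP Q0 <-]; apply/homogenizeP => e.
  by rewrite -map_mpoly_pihomog spec.
move=> /(_ P)[|Q /contract_relationsP Q0 QE].
  apply/homogenizeP => e; have [<-|de] := eqVneq d e.
    by rewrite mpoly.pihomog_dE.
  by rewrite (mpoly.pihomog_ne0 de) // rmorph0.
(* A preimage [Q] of [P] need not be homogeneous, but its component of degree [d] would be a
   homogeneous lift. *)
apply: (no_lift (mpoly.pihomog (@mpoly.mdeg _) d Q)) => //.
  by exists d; apply: mpoly.pihomogP.
by rewrite /ev map_mpoly_pihomog -/(ev alpha Q) QE mpoly.pihomog_dE.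
Qed.
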